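(* (a) Let $T$ be a rooted tree such that the forest $T'$ is a collection of cyclotomic trees and $\nu(T')>2$. Then $T$ is a Salem tree. (If instead $\nu(T')\le2$, then $T$ is a cyclotomic tree.) (b) Let $T_1$ and $T_2$ be rooted trees each of the type in (a) (i.e. $T_i'$ is a collection of cyclotomic trees and $\nu(T_i')>2$), with $(\nu(T_1')-2)(\nu(T_2')-2)\le1$. Then $T_1+T_2$ is a Salem tree. (If $(\nu(T_1')-2)(\nu(T_2')-2)>1$, then the reciprocal polynomial of $T_1+T_2$ has two roots outside the unit circle.) (c) Every Salem tree is, for a suitable choice of root, of the type in (a), or is of the form $T_1+T_2$ as in (b).
   Context: Graphs are finite simple graphs; eigenvalues are those of the adjacency matrix. A graph is cyclotomic if all its eigenvalues lie in $[-2,2]$. A bipartite graph (in particular a tree) is a Salem graph if it has exactly one eigenvalue $\lambda>2$ and only the eigenvalue $-\lambda$ in $(-\infty,-2)$; a Salem tree is a tree that is a Salem graph. For a tree $T$ on $n$ vertices with characteristic polynomial $\chi_T$, $R_T(z)=z^{n/2}\chi_T(\sqrt z+1/\sqrt z)$. A rooted tree has a distinguished vertex $r$; $T'$ is the rooted forest $T-\{r\}$, each component rooted at the vertex adjacent to $r$. The quotient of a rooted tree is $q_T=\prod_iR_{T_i}(z)/R_T(z)$ over the trees $T_i$ of $T'$; the quotient of a rooted forest is the sum of the quotients of its trees. The $\nu$-value of a rooted tree is $\nu(T)=q_T(1)$, with $\nu(T)=\infty$ if $q_T$ has a pole at $1$; for a forest, $\nu$ is the sum of the $\nu$-values of its trees.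 For rooted trees $T_1,T_2$, $T_1+T_2$ is the rooted tree obtained by joining their roots by an edge, rooted at the root of $T_1$. *)

(* Defs.v *)
From HB Require Import structures.
From mathcomp Require Import all_boot all_order all_algebra all_field.
From mathcomp Require Import constructive_ereal.
Set Implicit Arguments. Unset Strict Implicit. Unset Printing Implicit Defensive.
Import Order.TTheory GRing.Theory Num.Theory.
Local Open Scope ring_scope.

(* Graphs: an ambient finite type V with an adjacency relation e (assumed
   symmetric and irreflexive in the theorem); the graphs we consider are
   induced subgraphs on vertex sets S : {set V}. *)
Section Graphs.
Variables (V : finType) (e : rel V).

Definition simple_graph := symmetric e /\ irreflexive e.

Definition restrS (S : {set V}) : rel V :=
  [rel x y | [&& x \in S, y \in S & e x y]].

Definition adjmx (R : nzRingType) (S : {set V}) : 'M[R]_#|S| :=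
  \matrix_(i, j) (e (enum_val i) (enum_val j))%:R.

Definition connectedS (S : {set V}) :=
  forall x y, x \in S -> y \in S -> connect (restrS S) x y.

Definition nedges (S : {set V}) : nat :=
  #|[set p : V * V | restrS S p.1 p.2]|./2.

Definition is_tree (S : {set V}) :=
  S != set0 /\ connectedS S /\ nedges S = (#|S| - 1)%N.

Definition bipartite (S : {set V}) :=
  exists c : V -> bool, forall x y, restrS S x y -> c x != c y.

Definition is_eigenvalue (S : {set V}) (a : algC) := eigenvalue (adjmx algC S) a.

Definition cyclotomic_graph (S : {set V}) :=
  forall a, is_eigenvalue S a -> (-2 <= a <= 2).

Definition salem_graph (S : {set V}) :=
  bipartite S /\
  exists l : algC, [/\ 2 < l, is_eigenvalue S l,
     (forall m, is_eigenvalue S m -> 2 < m -> m = l) &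
     (forall m, is_eigenvalue S m -> m < -2 -> m = - l)].

Definition salem_tree (S : {set V}) := is_tree S /\ salem_graph S.

(* characteristic polynomial (over rat) and R_T(z) = z^(n/2) chi(sqrt z + 1/sqrt z),
   written out as a polynomial: x^j z^(n/2) = (z+1)^j z^((n-j)/2) for n-j even;
   for bipartite graphs the coefficients with n-j odd vanish. *)
Definition charpoly (S : {set V}) : {poly rat} := char_poly (adjmx rat S).

Definition Rpoly (S : {set V}) : {poly rat} :=
  let n := #|S| in let chi := charpoly S in
  \sum_(j < n.+1 | ~~ odd (n - j))
     chi`_j *: (('X + 1) ^+ j * 'X ^+ ((n - j)./2)).

Definition tcomp (S : {set V}) (u : V) : {set V} :=
  [set y | connect (restrS S) u y].

(* the components of T' = T - {r} (T rooted at r, vertex set S) are the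
   tcomp (S :\ r) u for the neighbours u of r in S, each rooted at u *)

Definition ratfun_at1 (P Q : {poly rat}) : \bar rat :=
  let g := gcdp P Q in
  let P' := P %/ g in let Q' := Q %/ g in
  if Q'.[1] == 0 then +oo%E else ((P'.[1] / Q'.[1])%:E)%E.

Definition quot_num (S : {set V}) (r : V) : {poly rat} :=
  \prod_(u in S | e r u) Rpoly (tcomp (S :\ r) u).

Definition nu (S : {set V}) (r : V) : \bar rat :=
  ratfun_at1 (quot_num S r) (Rpoly S).

Definition nu_forest (S : {set V}) (r : V) : \bar rat :=
  (\sum_(u in S | e r u) nu (tcomp (S :\ r) u) u)%E.

Definition forest_cyclotomic (S : {set V}) (r : V) :=
  forall u, u \in S -> e r u -> cyclotomic_graph (tcomp (S :\ r) u).

Definition rooted_tree (S : {set V}) (r : V) := is_tree S /\ r \in S.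

Definition typeA (S : {set V}) (r : V) :=
  [/\ rooted_tree S r, forest_cyclotomic S r & (2%:E < nu_forest S r)%E].

Definition is_join (S1 : {set V}) (r1 : V) (S2 : {set V}) (r2 : V) (S : {set V}) :=
  [/\ [disjoint S1 & S2], S = S1 :|: S2, r1 \in S1, r2 \in S2 &
      forall x y, x \in S1 -> y \in S2 -> e x y = (x == r1) && (y == r2)].

End Graphs.

Definition nroots_outside (p : {poly rat}) (k : nat) :=
  exists rs : seq algC,
    map_poly ratr p = lead_coef (map_poly ratr p) *: \prod_(z <- rs) ('X - z%:P)
    /\ count (fun z => 1 < `|z|) rs = k.

(* Main.v *)
Require Import Defs.
From HB Require Import structures.
From mathcomp Require Import all_boot all_order all_algebra all_field.
From mathcomp Require Import constructive_ereal.
From mathcomp Require Import ring lra zify.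
Set Implicit Arguments. Unset Strict Implicit. Unset Printing Implicit Defensive.
Import Order.TTheory GRing.Theory Num.Theory.
Local Open Scope ring_scope.

(* Write chi_S for the characteristic polynomial and f = chi_T / chi_(T - r) for
   a tree T with root r.  Expanding at the root gives
   f(x) = x - sum_i 1 / f_i(x) over the branches T_i of T - r, so by induction f
   is strictly increasing, with slope at least 1, wherever all eigenvalues of
   T - r lie to the left.  On (2, oo) this applies when T' is cyclotomic, and
   nu(T') = 2 - f(2), hence T has an eigenvalue above 2, necessarily unique, iff
   nu(T') > 2; this is (a).

   For (b), chi_(T1+T2) = chi_T1' chi_T2' (f1 f2 - 1).  Beyond the zeros of f1
   and f2 the product f1 f2 increases from 0 to oo, giving one simple root;
   between the zeros it is nonpositive; below both of them it decreases from
   (nu(T1') - 2)(nu(T2') - 2) to 0, giving a second simple root iff that number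
   exceeds 1.

   For (c), take a smallest noncyclotomic branch at an edge of T.  By the spectral
   theorem two disjoint nonadjacent noncyclotomic subtrees force two eigenvalues
   above 2, so the rest of T, cut along this edge, has a cyclotomic forest. *)

(** * Determinants and the characteristic polynomial *)

(** Eigenvalues are real algebraic, so the analysis is done over [algR], where every [chi] splits:
    intermediate value arguments become sign counts of linear factors, and limits become
    inequalities between polynomials with cleared denominators ([poly_ge0_right]).

    The obstacle is the endpoint x = 2, which corresponds to z = 1. For cyclotomic T', chi_(T - r)
    vanishes there exactly when nu(T') is infinite. Two facts control this. A branch without
    eigenvalues above 2 has a positive root-deleted polynomial at 2 (a Perron-Frobenius statement,
    [chi_D1_gt0]), so no cancellation in its quotient hides a pole; and a lower bound for f to the
    right of 2 excludes a pole of f at 2.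

    In (c) the bound on the product is not computed: if it failed, (b) would give two distinct
    eigenvalues above 2. The spectral argument of (c) counts eigenvalues with multiplicity, so
    simplicity of the largest one is proved separately. *)

Lemma det_add1_mulmxC (R : comNzRingType) m n (B : 'M[R]_(m, n)) (C : 'M_(n, m)) :
  \det (1%:M + B *m C) = \det (1%:M + C *m B).
Proof.
(* Sylvester's identity: one block matrix is factored twice, eliminating either diagonal block. *)
have e1 : block_mx 1%:M (- B) C 1%:M =
    block_mx 1%:M 0 C 1%:M *m block_mx 1%:M (- B) 0 (1%:M + C *m B).
  by rewrite mulmx_block !mul1mx !mul0mx ?mulmx1 ?mulmx0 !addr0 mulmxN [1%:M + _]addrC addKr.
have e2 : block_mx 1%:M (- B) C 1%:M =
    block_mx 1%:M (- B) 0 1%:M *m block_mx (1%:M + B *m C) 0 C 1%:M.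
  by rewrite mulmx_block !mul1mx !mul0mx ?mulmx1 ?mulmx0 !add0r mulNmx addrK.
have := e2; rewrite e1 => /(congr1 determinant).
by rewrite !det_mulmx !det_lblock !det_ublock !det1 !mul1r mulr1.
Qed.

Lemma det_add1_rank1 (R : comNzRingType) n (u : 'cV[R]_n) (v : 'rV_n) :
  \det (1%:M + u *m v) = 1 + (v *m u) 0 0.
Proof. by rewrite det_add1_mulmxC det_mx11 !mxE. Qed.

Lemma oppmxE (R : zmodType) m n (A : 'M[R]_(m, n)) i j : (- A) i j = - A i j.
Proof. by rewrite mxE. Qed.

Lemma addmxE (R : nmodType) m n (A B : 'M[R]_(m, n)) i j :
  (A + B) i j = A i j + B i j.
Proof. by rewrite mxE. Qed.

Lemma scalemxE (R : pzRingType) m n a (A : 'M[R]_(m, n)) i j :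
  (a *: A) i j = a * A i j.
Proof. by rewrite mxE. Qed.

(** * Determinants of padded adjacency matrices *)

Section AmbientMatrix.
Variables (V : finType) (e : rel V) (K : fieldType).
Implicit Types (S : {set V}).

(* The adjacency matrix of [S] padded with zeros to the whole vertex type, so
   that all sets share one matrix size. *)
Definition padmx S : 'M[K]_#|V| :=
  \matrix_(i, j) (restrS e S (enum_val i) (enum_val j))%:R.

Definition unitcol (v : V) : 'cV[K]_#|V| := \col_i (enum_val i == v)%:R.

Lemma unitcolM m (B : 'M[K]_(m, _)) v i : (B *m unitcol v) i 0 = B i (enum_rank v).
Proof.
rewrite !mxE (bigD1 (enum_rank v)) //= !mxE enum_rankK eqxx mulr1 big1 ?addr0 //.
move=> j; rewrite mxE => jv; case: eqP => [/(canRL enum_valK)|]; last by rewrite mulr0.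
by move=> jE; rewrite jE eqxx in jv.
Qed.

Lemma unitrowM m (B : 'M[K]_(_, m)) v i :
  ((unitcol v)^T *m B) 0 i = B (enum_rank v) i.
Proof. by rewrite -[_ *m B]trmxK trmx_mul trmxK mxE unitcolM mxE. Qed.

(** The padded matrix is E^T A E with E E^T = 1, where E selects the rows of [S]; Sylvester's
    identity then moves the determinant down to size #|S|. *)
Lemma det_sub_padmx S (x : K) : x != 0 ->
  (char_poly (adjmx e K S)).[x] = x ^+ #|S| * \det (1%:M - x^-1 *: padmx S).
Proof.
move=> x0.
pose E : 'M[K]_(#|S|, #|V|) := \matrix_(i, j) (enum_val i == enum_val j)%:R.
have EE : E *m E^T = 1%:M.
  apply/matrixP=> i j; rewrite !mxE (bigD1 (enum_rank (enum_val i))) //= !mxE.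
  rewrite enum_rankK eqxx mul1r big1 ?addr0.
    by rewrite eq_sym (inj_eq enum_val_inj).
  move=> k; rewrite !mxE => ki; case: eqP => [h|]; last by rewrite mul0r.
  by rewrite h enum_valK eqxx in ki.
have padE : padmx S = E^T *m (adjmx e K S *m E).
  apply/matrixP=> i j; rewrite !mxE.
  have [iS|iS] := boolP (enum_val i \in S); last first.
    rewrite /restrS /= (negPf iS) /= big1 // => k _; rewrite !mxE.
    by case: eqP (enum_valP k) => [->|]; rewrite ?mul0r // (negPf iS).
  rewrite (bigD1 (enum_rank_in iS (enum_val i))) //= !mxE enum_rankK_in // eqxx mul1r.
  rewrite [X in _ + X]big1 ?addr0 => [|k ki]; last first.
    rewrite !mxE; case: eqP => [h|]; last by rewrite mul0r.
    case/eqP: ki; apply: enum_val_inj; by rewrite h enum_rankK_in.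
  have [jS|jS] := boolP (enum_val j \in S); last first.
    rewrite /restrS /= (negPf jS) /= iS /= big1 // => k _; rewrite !mxE.
    by case: eqP (enum_valP k) => [->|]; rewrite ?mulr0 // (negPf jS).
  rewrite (bigD1 (enum_rank_in jS (enum_val j))) //= !mxE !enum_rankK_in // eqxx mulr1.
  rewrite [X in _ + X]big1 ?addr0 => [|k ki]; last first.
    rewrite !mxE; case: eqP => [h|]; last by rewrite mulr0.
    case/eqP: ki; apply: enum_val_inj; by rewrite h enum_rankK_in.
  by rewrite /restrS /= iS jS.
rewrite padE scalemxAr -mulmxN det_add1_mulmxC mulNmx scalemxAl -mulmxA EE mulmx1.
rewrite -detZ scalerBr scalerA mulfV // scale1r scalemx1.
rewrite -horner_evalE -det_map_mx; congr determinant.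
apply/matrixP=> i j; rewrite !mxE.
by rewrite /= horner_evalE hornerD hornerN hornerC hornerMn hornerX.
Qed.


Hypothesis (esym : symmetric e) (eirr : irreflexive e).
Variable t : K.
(** With t = 1/x this is (x - A)/x on [S] and the identity elsewhere, so vertices outside [S] do not
    affect its determinant. *)
Definition idsubmx S : 'M[K]_#|V| := 1%:M - t *: padmx S.
Local Notation M := idsubmx.

Lemma padmx_tr S : (padmx S)^T = padmx S.
Proof.
by apply/matrixP=> i j; rewrite !mxE /restrS /= esym; case: (_ \in S); rewrite ?andbF.
Qed.

Lemma padmx_unitcol S v : v \notin S -> padmx S *m unitcol v = 0.
Proof.
move=> vS; apply/matrixP=> i j; rewrite ord1 unitcolM !mxE enum_rankK /restrS /=.
by rewrite (negPf vS) andbF.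
Qed.

Lemma M_unitcol S v : v \notin S -> M S *m unitcol v = unitcol v.
Proof. by move=> vS; rewrite /idsubmx mulmxBl mul1mx -scalemxAl padmx_unitcol // scaler0 subr0. Qed.

Lemma M_tr S : (M S)^T = M S.
Proof. by rewrite /idsubmx linearB linearZ /= trmx1 padmx_tr. Qed.

Lemma M_unitrow S v : v \notin S -> (unitcol v)^T *m M S = (unitcol v)^T.
Proof. by move=> vS; rewrite -{1}M_tr -trmx_mul M_unitcol. Qed.

Lemma invM_unitcol S v : M S \in unitmx -> v \notin S ->
  invmx (M S) *m unitcol v = unitcol v.
Proof. by move=> uM vS; rewrite -{1}(M_unitcol vS) mulKmx. Qed.

Lemma invM_unitrow S v : M S \in unitmx -> v \notin S ->
  (unitcol v)^T *m invmx (M S) = (unitcol v)^T.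
Proof. by move=> uM vS; rewrite -{1}(M_unitrow vS) mulmxK. Qed.

Lemma padmx_mul0 S1 S2 : [disjoint S1 & S2] -> padmx S1 *m padmx S2 = 0.
Proof.
move=> dis; apply/matrixP=> i j; rewrite !mxE big1 // => k _; rewrite !mxE /restrS /=.
have [kS|] := boolP (enum_val k \in S1); last by rewrite andbF mul0r.
by rewrite (disjointFr dis kS) mulr0.
Qed.

Lemma M_mul S1 S2 : [disjoint S1 & S2] ->
  M S1 *m M S2 = 1%:M - t *: (padmx S1 + padmx S2).
Proof.
move=> dis; rewrite /idsubmx mulmxBl mul1mx mulmxBr mulmx1 -scalemxAl -scalemxAr.
by rewrite padmx_mul0 // !scaler0 subr0 scalerDr opprD addrA addrAC.
Qed.

(** Padded matrices of disjoint sets annihilate each other, so the product of the two matrices is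
    already the matrix of the union. *)
Lemma det_M_disjoint S1 S2 : [disjoint S1 & S2] ->
  (forall x y, x \in S1 -> y \in S2 -> ~~ e x y) ->
  \det (M (S1 :|: S2)) = \det (M S1) * \det (M S2).
Proof.
move=> dis noe; rewrite -det_mulmx M_mul // /idsubmx; congr (\det (_ - _ *: _)).
apply/matrixP=> i j; rewrite !mxE /restrS /= !inE.
have noe' x y : x \in S2 -> y \in S1 -> ~~ e x y by move=> *; rewrite esym noe.
have := noe (enum_val i) (enum_val j); have := noe' (enum_val i) (enum_val j).
have := disjointFr dis (x := enum_val i); have := disjointFr dis (x := enum_val j).
case: (enum_val i \in S1); case: (enum_val i \in S2); case: (enum_val j \in S1);
  case: (enum_val j \in S2) => //= h1 h2 h3 h4;
  rewrite ?addr0 ?add0r //; try by [have := h1 isT | have := h2 isT].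
  by rewrite (negPf (h4 isT isT)).
by rewrite (negPf (h3 isT isT)).
Qed.

(** Cramer's formula for a diagonal entry of the inverse. The padded matrix keeps its size when [r]
    is deleted, so rank-one updates take the place of a minor. *)
Lemma det_M_setD1 S r : M S \in unitmx -> r \in S ->
  \det (M (S :\ r)) = \det (M S) * invmx (M S) (enum_rank r) (enum_rank r).
Proof.
move=> uM rS; pose b := padmx S *m unitcol r; pose er := unitcol r.
have br : (er^T *m b) 0 0 = 0.
  by rewrite /b mulmxA unitcolM unitrowM mxE enum_rankK /restrS /= eirr !andbF.
have bT : b^T = er^T *m padmx S by rewrite trmx_mul padmx_tr.
have padE : padmx S = padmx (S :\ r) + b *m er^T + er *m b^T.
  have bE k : b k 0 = (restrS e S (enum_val k) r)%:R by rewrite unitcolM mxE enum_rankK.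
  apply/matrixP=> i j; rewrite !mxE !big_ord1 ![_^T _ _]mxE !bE ![er _ _]mxE.
  rewrite /restrS /= !inE rS /=.
  have [->|ir] := eqVneq (enum_val i) r; have [->|jr] := eqVneq (enum_val j) r => /=.
  - by rewrite eirr !andbF !(mulr0, mul0r, addr0).
  - by rewrite rS mulr0 !add0r mul1r esym.
  - by rewrite rS andbF mul0r add0r addr0 mulr1.
  - by rewrite mulr0 mul0r !addr0.
(* Deleting [r] removes a column part and a row part. The factor on the left handles the column and
   has determinant 1, there being no loop at [r]; the row becomes the rank-one factor on the
   right. *)
have e1 : (1%:M - (t *: b) *m er^T) *m M (S :\ r) = M S *m (1%:M + invmx (M S) *m er *m (t *: b^T)).
  rewrite [RHS]mulmxDr mulmx1 -[_ *m er *m _]mulmxA mulKVmx //.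
  rewrite mulmxBl mul1mx -mulmxA M_unitrow ?inE ?eqxx // {2}/idsubmx padE -scalemxAl -scalemxAr.
  by rewrite /idsubmx; apply/matrixP=> i j; rewrite !mxE; ring.
have := congr1 determinant e1; rewrite !det_mulmx det_add1_rank1 -mulNmx det_add1_rank1.
rewrite mulmxN -scalemxAr oppmxE scalemxE br mulr0 oppr0 addr0 mul1r => ->.
congr (_ * _).
have -> : t *: b^T = er^T - er^T *m M S.
  by rewrite /idsubmx mulmxBr mulmx1 -scalemxAr bT opprB addrCA subrr addr0.
rewrite mulmxBl addmxE oppmxE mulmxA unitcolM unitrowM addrCA.
rewrite -!mulmxA mulKVmx // unitrowM mxE enum_rankK eqxx subrr addr0 //.
Qed.

(** The edge is added one orientation at a time. The entry (r1, r2) is absorbed in the product [B],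
    whose middle factor has determinant 1; the entry (r2, r1) is then a rank-one update of [B],
    which produces diagonal entries of both inverses, hence root-deleted determinants. *)
Lemma det_M_join S1 r1 S2 r2 S : is_join e S1 r1 S2 r2 S ->
  M S1 \in unitmx -> M S2 \in unitmx ->
  \det (M S) = \det (M S1) * \det (M S2)
                - t ^+ 2 * (\det (M (S1 :\ r1)) * \det (M (S2 :\ r2))).
Proof.
case=> dis -> r1S r2S eE u1 u2.
have r12 : r1 \notin S2 by rewrite (disjointFr dis r1S).
have r21 : r2 \notin S1 by rewrite (disjointFl dis r2S).
pose e1 := unitcol r1; pose e2 := unitcol r2.
pose B := M S2 *m (1%:M - t *: (e1 *m e2^T)) *m M S1.
have e21 : (e2^T *m e1) = 0.
  apply/matrixP=> i j; rewrite !ord1 unitcolM !mxE enum_rankK.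
  by case: eqP r21 => // <-; rewrite r1S.
have u0 : (1%:M - t *: (e1 *m e2^T)) *m (1%:M + t *: (e1 *m e2^T)) = 1%:M.
  rewrite mulmxBl mul1mx mulmxDr mulmx1 -scalemxAr -scalemxAl mulmxA -(mulmxA e1) e21.
  by rewrite mulmx0 mul0mx !scaler0 addr0 addrK.
have dis' : [disjoint S2 & S1] by rewrite disjoint_sym.
have BE : B = 1%:M - t *: (padmx S1 + padmx S2) - t *: (e1 *m e2^T).
  rewrite /B [M S2 *m _]mulmxBr mulmx1 [LHS]mulmxBl M_mul // [padmx S2 + _]addrC.
  by rewrite -scalemxAr -scalemxAl mulmxA M_unitcol // -mulmxA M_unitrow.
have padE : padmx (S1 :|: S2) = padmx S1 + padmx S2 + e1 *m e2^T + e2 *m e1^T.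
  apply/matrixP=> i j; rewrite !mxE !big_ord1 !mxE /restrS /= !inE.
  have := eE (enum_val i) (enum_val j); have := eE (enum_val j) (enum_val i).
  have := disjointFr dis (x := enum_val i); have := disjointFr dis (x := enum_val j).
  rewrite (esym (enum_val j)).
  have [iS1|iS1] := boolP (enum_val i \in S1); have [jS1|jS1] := boolP (enum_val j \in S1).
  - move=> /(_ isT) jS2 /(_ isT) iS2; rewrite iS2 jS2 /= => _ _.
    have [h|] := eqVneq (enum_val j) r2; first by rewrite -h jS1 in r21.
    have [h|] := eqVneq (enum_val i) r2; first by rewrite -h iS1 in r21.
    by rewrite mulr0 mul0r !addr0.
  - move=> _ /(_ isT) iS2; rewrite iS2 /= => _ h.
    have [jS2|jS2] := boolP (enum_val j \in S2).
      rewrite h //= ; have [h'|] := eqVneq (enum_val i) r2; first by rewrite -h' iS1 in r21.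
      by rewrite mul0r addr0 !add0r -natrM mulnb.
    have [h'|] := eqVneq (enum_val j) r2; first by rewrite h' r2S in jS2.
    have [h'|] := eqVneq (enum_val j) r1; first by rewrite h' r1S in jS1.
    by rewrite !mulr0 !addr0.
  - move=> /(_ isT) jS2 _; rewrite jS2 /= andbF => h _.
    have [iS2|iS2] := boolP (enum_val i \in S2).
      rewrite h //= ; have [h'|] := eqVneq (enum_val j) r2; first by rewrite -h' jS1 in r21.
      by rewrite mulr0 !add0r -natrM mulnb andbC.
    have [h'|] := eqVneq (enum_val i) r2; first by rewrite h' r2S in iS2.
    have [h'|] := eqVneq (enum_val i) r1; first by rewrite h' r1S in iS1.
    by rewrite !mul0r !addr0.
  - move=> _ _ _ _ /=.
    have [h'|] := eqVneq (enum_val i) r1; first by rewrite h' r1S in iS1.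
    have [h'|] := eqVneq (enum_val j) r1; first by rewrite h' r1S in jS1.
    by rewrite mulr0 mul0r add0r !addr0.
have ME : M (S1 :|: S2) = B - t *: (e2 *m e1^T).
  by rewrite BE /idsubmx padE; apply/matrixP=> i j; rewrite !mxE; ring.
have dB : \det B = \det (M S1) * \det (M S2).
  rewrite !det_mulmx scalemxAl -mulNmx det_add1_rank1 mulmxN -scalemxAr e21.
  by rewrite scaler0 oppr0 mxE addr0 mulr1 mulrC.
have uB : B \in unitmx.
  by move: u1 u2; rewrite !unitmxE dB !unitrM => -> ->.
have iB : invmx B = invmx (M S1) *m (1%:M + t *: (e1 *m e2^T)) *m invmx (M S2).
  apply: (can_inj (mulKmx uB)); rewrite mulmxV // /B.
  rewrite -!mulmxA mulKVmx // [_ *m (_ *m invmx (M S2))]mulmxA u0 mul1mx mulmxV //.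
have ME' : M (S1 :|: S2) = B *m (1%:M - (t *: invmx B *m e2) *m e1^T).
  by rewrite mulmxBr mulmx1 !mulmxA -scalemxAr mulmxV // ME -!scalemxAl mul1mx.
rewrite ME' det_mulmx dB -mulNmx det_add1_rank1 (det_M_setD1 u1 r1S) (det_M_setD1 u2 r2S).
rewrite mulmxN -!scalemxAl -scalemxAr oppmxE scalemxE iB.
have c12 : invmx (M S1) *m invmx (M S2) = invmx (M S2) *m invmx (M S1).
  apply: (can_inj (mulKmx u1)); rewrite mulKVmx //.
  apply: (can_inj (mulKmx u2)); rewrite mulmxV //.
  by rewrite mulmxA M_mul // [padmx S2 + _]addrC -M_mul // -mulmxA mulKVmx // mulmxV.
have -> : e1^T *m (invmx (M S1) *m (1%:M + t *: (e1 *m e2^T)) *m invmx (M S2) *m e2)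
   = e1^T *m invmx (M S1) *m e1 *m (t *: (e2^T *m invmx (M S2) *m e2)).
  (* The identity part of the middle factor contributes nothing: after commuting the inverses, each
     fixes the unit vector of the other side, and these vectors are orthogonal. *)
  have z : e1^T *m (invmx (M S1) *m invmx (M S2)) *m e2 = 0.
    rewrite c12 mulmxA invM_unitrow // -mulmxA invM_unitcol //.
    by rewrite -[e1^T *m e2]trmxK trmx_mul trmxK e21 trmx0.
  rewrite mulmxDr mulmx1 !(mulmxDl _ _ (invmx (M S2))) !(mulmxDl _ _ e2).
  rewrite (mulmxDr e1^T) mulmxA z add0r -!(scalemxAl, scalemxAr) !mulmxA //.
rewrite -scalemxAr scalemxE [(_ *m _ *m e1 *m _) 0 0]mxE big_ord1.
rewrite !unitcolM !unitrowM; ring.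
Qed.

End AmbientMatrix.

(** * Product and edge formulas for the characteristic polynomial *)

Section CharPoly.
Variables (V : finType) (e : rel V).
Implicit Types (S : {set V}).

Definition chi (F : fieldType) S : {poly F} := char_poly (adjmx e F S).

Lemma chi_monic F S : chi F S \is monic.
Proof. exact: char_poly_monic. Qed.

Lemma size_chi F S : size (chi F S) = #|S|.+1.
Proof. exact: size_char_poly. Qed.

Lemma map_chi (F K : fieldType) (f : {rmorphism F -> K}) S :
  map_poly f (chi F S) = chi K S.
Proof.
rewrite /chi map_char_poly; congr char_poly.
by apply/matrixP=> i j; rewrite !mxE rmorph_nat.
Qed.

Variable F : fieldType.

(* The fraction field of {poly F}, hidden so that unification never unfolds it. *)
Lemma chi_det_embedding : exists (K : fieldType) (f : {rmorphism {poly F} -> K}) (x : K),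
  [/\ injective f, x != 0,
    forall S, f (chi F S) = x ^+ #|S| * \det (idsubmx e x^-1 S)
    & forall S, idsubmx e x^-1 S \in unitmx].
Proof.
pose K : fieldType := {fraction {poly F}}.
pose f : {rmorphism {poly F} -> K} := @FracField.tofrac {poly F}.
have xn0 : f 'X != 0 by rewrite tofrac_eq0 polyX_eq0.
have E S : f (chi F S) = f 'X ^+ #|S| * \det (idsubmx e (f 'X)^-1 S).
  rewrite -det_sub_padmx // -/(chi K S) -(map_chi (f \o polyC)) map_poly_comp /= horner_map.
  by rewrite -/(comp_poly 'X (chi F S)) comp_polyXr.
exists K, f, (f 'X); split; [|exact: xn0 | exact: E | move=> S].
  by move=> p q /eqP; rewrite tofrac_eq => /eqP.
have : f (chi F S) != 0 by rewrite tofrac_eq0 monic_neq0 ?chi_monic.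
by rewrite unitmxE unitfE; apply: contraNneq => d0; rewrite (E S) d0 mulr0.
Qed.

Hypothesis sg : simple_graph e.

Lemma chi_disjoint S1 S2 : [disjoint S1 & S2] ->
  (forall x y, x \in S1 -> y \in S2 -> ~~ e x y) ->
  chi F (S1 :|: S2) = chi F S1 * chi F S2.
Proof.
case: sg chi_det_embedding => esym eirr [K [f [x [fI x0 E uM]]]] dis noe; apply: fI.
rewrite rmorphM !E det_M_disjoint // cardsU (disjoint_setI0 dis) cards0 subn0.
by rewrite exprD mulrACA.
Qed.

(** Over the fraction field all matrices [idsubmx] are invertible, so [det_M_join] applies with no
    exceptional x. Its factor x^-2 accounts for the two deleted vertices. *)
Lemma chi_join S1 r1 S2 r2 S : is_join e S1 r1 S2 r2 S ->
  chi F S = chi F S1 * chi F S2 - chi F (S1 :\ r1) * chi F (S2 :\ r2).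
Proof.
case: sg chi_det_embedding => esym eirr [K [f [x [fI x0 E uM]]]] J; apply: fI.
rewrite rmorphB !rmorphM !E (det_M_join esym eirr J (uM _) (uM _)).
case: J => dis -> r1S r2S _.
rewrite cardsU (disjoint_setI0 dis) cards0 subn0 (cardsD1 r1 S1) (cardsD1 r2 S2) r1S r2S.
rewrite !add1n !exprD !exprS; set d1 := \det _; set d2 := \det _.
by set d3 := \det _; set d4 := \det _; field.
Qed.

Lemma chi_set1 r : chi F [set r] = 'X.
Proof.
case: sg => _ eirr; rewrite /chi /char_poly.
have A0 : adjmx e F [set r] = 0.
  apply/matrixP=> i j; rewrite !mxE; have := enum_valP i; have := enum_valP j.
  by rewrite !inE => /eqP-> /eqP->; rewrite eirr.
by rewrite A0 /char_poly_mx map_mx0 subr0 det_scalar cards1 expr1.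
Qed.

Lemma chi_set0 : chi F set0 = 1.
Proof.
have s1 : size (chi F set0) = 1%N by rewrite size_chi cards0.
have /monicP := chi_monic F set0.
by rewrite lead_coefE s1 (size1_polyC (eq_leq s1)) coefC /= => ->.
Qed.

Lemma chi_bigcup (us : seq V) (B : V -> {set V}) : uniq us ->
  {in us &, forall u v, u != v -> [disjoint B u & B v] /\
     forall x y, x \in B u -> y \in B v -> ~~ e x y} ->
  chi F (\bigcup_(u <- us) B u) = \prod_(u <- us) chi F (B u).
Proof.
elim: us => [|u us IH] /=; first by rewrite !big_nil chi_set0.
case/andP=> uus uq h; rewrite !big_cons chi_disjoint.
- by rewrite IH // => v w vus wus; apply: h; rewrite inE ?vus ?wus orbT.
- rewrite bigcup_seq; apply: bigcup_disjoint => v vus.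
  have uv : v != u by apply: contraNneq uus => <-.
  by rewrite disjoint_sym; case: (h v u); rewrite ?inE ?vus ?eqxx ?orbT.
move=> y z yu; rewrite bigcup_seq => /bigcupP[v vus zv].
have uv : u != v by apply: contraNneq uus => ->.
by case: (h u v) => [|||_]; rewrite ?inE ?vus ?eqxx ?orbT //; apply.
Qed.

End CharPoly.

(** Conjugation by the diagonal matrix of signs of the two colour classes negates the adjacency
    matrix. *)
Lemma chi_compN (V : finType) (e : rel V) (F : fieldType) (S : {set V}) :
  bipartite e S -> chi e F S \Po (- 'X) = (-1) ^+ #|S| *: chi e F S.
Proof.
case=> c cP; pose d := \row_(i < #|S|) ((-1) ^+ (c (enum_val i)) : {poly F}).
have dd i : d 0 i * d 0 i = 1 by rewrite mxE -expr2 sqrr_sign.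
have detd : \det (diag_mx d) * \det (diag_mx d) = 1.
  by rewrite !det_diag -big_split big1 //= => i _; rewrite dd.
transitivity (\det (- (diag_mx d *m char_poly_mx (adjmx e F S) *m diag_mx d))).
  rewrite -[_ \Po _]/((comp_poly (- 'X)) _) -det_map_mx; congr determinant.
  apply/matrixP=> i j; rewrite oppmxE mul_mx_diag [in RHS]mxE mul_diag_mx [in RHS]mxE.
  rewrite !mxE rmorphB /= rmorphMn /= comp_polyX comp_polyC.
  have [<-|ij] := eqVneq i j; rewrite ?mulr1n ?mulr0n.
    rewrite mulrAC -expr2 sqrr_sign mul1r opprB addrC.
    have := cP (enum_val i) (enum_val i); rewrite /restrS /= !enum_valP eqxx /=.
    by case: (e _ _) => [/(_ isT)|] // _; rewrite polyC0 ?oppr0 ?subr0 ?add0r ?addr0.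
  have := cP (enum_val i) (enum_val j); rewrite /restrS /= !enum_valP /=.
  case: (e _ _) => [/(_ isT)|_]; last by rewrite subrr mulr0 mul0r oppr0.
  by do 2!case: (c _) => //; rewrite ?expr0 ?expr1 => _; ring.
rewrite -scaleN1r detZ !det_mulmx mulrAC detd mul1r -mul_polyC.
by rewrite polyC_exp polyCN polyC1.
Qed.

Lemma horner_chiN (V : finType) (e : rel V) (F : fieldType) (S : {set V}) x :
  bipartite e S -> (chi e F S).[- x] = (-1) ^+ #|S| * (chi e F S).[x].
Proof.
by move/(chi_compN F)/(congr1 (fun p => p.[x])); rewrite horner_comp hornerZ !hornerE.
Qed.

(** This is what allows [Rpoly] to sum only over the j with n - j even. *)
Lemma coef_chi_bipartite (V : finType) (e : rel V) (S : {set V}) j :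
  bipartite e S -> (j <= #|S|)%N -> odd (#|S| - j) -> (chi e rat S)`_j = 0.
Proof.
move=> bS jS oj; have := congr1 (fun p : {poly rat} => p`_j) (chi_compN rat bS).
rewrite /= coefZ comp_polyE coef_sum.
under eq_bigr => i _ do rewrite -mulN1r exprMn -polyCN -polyC_exp mul_polyC scalerA coefZ coefXn.
rewrite size_chi (bigD1 (Ordinal (jS : (j < #|S|.+1)%N))) //= eqxx mulr1 big1 ?addr0; last first.
  by move=> i ij; case: eqP => [ji|]; rewrite ?mulr0 //; case/eqP: ij; apply: val_inj.
rewrite -[in LHS]signr_odd -[in RHS]signr_odd.
have := oj; rewrite oddB //.
by case: (odd j); case: (odd #|S|) => //= _; rewrite ?expr0 ?expr1; lra.
Qed.

(** * Spectral theorem and Rayleigh bound for Hermitian matrices *)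

Section Spectral.
Local Open Scope sesquilinear_scope.

Lemma trmxC_mul m n p (M : 'M[algC]_(m, n)) (N : 'M_(n, p)) : (M *m N)^t* = N^t* *m M^t*.
Proof. by rewrite trmx_mul map_mxM. Qed.

Lemma trmxC_K m n (M : 'M[algC]_(m, n)) : (M^t*)^t* = M.
Proof. by apply/matrixP=> i j; rewrite !mxE conjCK. Qed.

Local Notation C := algC.
Variables (n : nat) (A : 'M[C]_n).
Hypothesis hA : A \is hermsymmx.
Let P := spectralmx A.
Let d := spectral_diag A.

Lemma spectral_decomp : A = P^t* *m diag_mx d *m P.
Proof.
have /orthomx_spectralP := hermitian_normalmx hA.
by rewrite invmx_unitary ?spectral_unitarymx.
Qed.

Let PP : P^t* *m P = 1%:M.
Proof. by rewrite -invmx_unitary ?spectral_unitarymx // mulVmx // spectral_unit. Qed.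

Lemma char_poly_spectral : char_poly A = \prod_i ('X - (d 0 i)%:P).
Proof.
rewrite /char_poly; have -> : char_poly_mx A =
    map_mx polyC (P^t*) *m char_poly_mx (diag_mx d) *m map_mx polyC P.
  rewrite /char_poly_mx mulmxBr mulmxBl -!map_mxM -spectral_decomp; congr (_ - _).
  by rewrite scalar_mxC -mulmxA -map_mxM PP map_mx1 mulmx1.
rewrite !det_mulmx mulrAC -det_mulmx -map_mxM PP map_mx1 det1 mul1r.
rewrite -/(char_poly _) char_poly_trig ?diag_mx_is_trig //.
by apply: eq_bigr => i _; rewrite mxE eqxx mulr1n.
Qed.

Lemma spectral_quadE (w : 'rV_n) :
  (w *m A *m w^t*) 0 0 = \sum_i d 0 i * `|(w *m P^t*) 0 i| ^+ 2.
Proof.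
rewrite {1}spectral_decomp; set y := w *m P^t*.
have -> : w *m (P^t* *m diag_mx d *m P) *m w^t* = y *m diag_mx d *m y^t*.
  by rewrite [y^t*]trmxC_mul trmxC_K !mulmxA.
rewrite mul_mx_diag mxE; apply: eq_bigr => i _; rewrite !mxE normCK; ring.
Qed.

Lemma spectral_normE (w : 'rV_n) : (w *m w^t*) 0 0 = \sum_i `|(w *m P^t*) 0 i| ^+ 2.
Proof.
set y := w *m P^t*.
have -> : w *m w^t* = y *m y^t*.
  rewrite [y^t*]trmxC_mul trmxC_K /y.
  by rewrite -!mulmxA [_ *m (P *m _)]mulmxA PP mul1mx.
by rewrite mxE; apply: eq_bigr => i _; rewrite !mxE normCK.
Qed.

(** The hypothesis says that [w] is orthogonal to every eigenvector with eigenvalue above [a]; no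
    bound on the whole spectrum is assumed, which [two_roots_gt] exploits. *)
Lemma rayleigh_le (a : C) (w : 'rV_n) : a \is Num.real ->
  (forall i, a < d 0 i -> (w *m P^t*) 0 i = 0) ->
  (w *m A *m w^t*) 0 0 <= a * (w *m w^t*) 0 0.
Proof.
move=> ra h; rewrite spectral_quadE spectral_normE mulr_sumr; apply: ler_sum => i _.
have rd : d 0 i \is Num.real by have /mxOverP := hermitian_spectral_diag_real hA; apply.
have [da|ad] := real_leP rd ra; last by rewrite h // normr0 expr2 mulr0 !mulr0.
by rewrite ler_wpM2r // exprn_ge0.
Qed.

End Spectral.

(** * Real spectra and Rayleigh quotients *)

Section Interlacing.
Local Open Scope sesquilinear_scope.
Variables (V : finType) (e : rel V).
Hypothesis sg : simple_graph e.
Implicit Types (S T U : {set V}).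
Local Notation C := algC.
Local Notation A S := (adjmx e C S).

Lemma adjmx_herm S : A S \is hermsymmx.
Proof.
case: sg => esym _; apply/is_hermitianmxP; rewrite expr0 scale1r.
by apply/matrixP=> i j; rewrite !mxE esym conj_Creal // realn.
Qed.

(** The same list serves two purposes: sign arguments use the factorization over [algR], Rayleigh
    quotients use the spectral diagonal. *)
Lemma chi_spectrum S : exists s : seq algR,
  chi e algR S = \prod_(l <- s) ('X - l%:P) /\
  map algRval s = [seq spectral_diag (A S) 0 i | i <- enum 'I_#|S|].
Proof.
have rd i : spectral_diag (A S) 0 i \is Num.real.
  by have /mxOverP := hermitian_spectral_diag_real (adjmx_herm S); apply.
pose s := [seq in_algR (rd i) | i <- enum 'I_#|S|].
have sE : map algRval s = [seq spectral_diag (A S) 0 i | i <- enum 'I_#|S|].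
  by rewrite -map_comp; apply: eq_map.
exists s; split=> //; apply: (map_poly_inj (@algRval : {rmorphism algR -> algC})).
rewrite map_chi rmorph_prod /= /chi (char_poly_spectral (adjmx_herm S)).
under [RHS]eq_bigr => i _ do rewrite rmorphB /= map_polyX map_polyC.
rewrite -(big_map algRval xpredT (fun x => 'X - x%:P)) sE big_map.
by rewrite big_enum.
Qed.

Lemma chi_split S : exists s : seq algR, chi e algR S = \prod_(l <- s) ('X - l%:P).
Proof. by have [s []] := chi_spectrum S; exists s. Qed.

Lemma eigenvalue_chi S (a : algC) :
  is_eigenvalue e S a <-> exists2 x : algR, a = algRval x & root (chi e algR S) x.
Proof.
rewrite /is_eigenvalue eigenvalue_root_char -/(chi e C S).
rewrite -(map_chi e (@algRval : {rmorphism algR -> algC})).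
have [s sE] := chi_split S; split=> [|[x -> rx]]; last by rewrite fmorph_root.
rewrite sE rmorph_prod /=.
under eq_bigr => i _ do rewrite rmorphB /= map_polyX map_polyC.
rewrite -(big_map algRval xpredT (fun x => 'X - x%:P)) root_prod_XsubC => /mapP[x xs ->].
by exists x; rewrite // root_prod_XsubC.
Qed.

Section Selection.
Variable S : {set V}.

(** Right multiplication by this matrix extends a row vector on a subset [T] of [S] by zero to
    [S]. *)
Definition selmx T : 'M[C]_(#|T|, #|S|) := \matrix_(i, j) (enum_val i == enum_val j)%:R.

Lemma selmxM T m (i : 'I_#|T|) (B : 'M_(#|S|, m)) j (h : enum_val i \in S) :
  (selmx T *m B) i j = B (enum_rank_in h (enum_val i)) j.
Proof.
rewrite mxE (bigD1 (enum_rank_in h (enum_val i))) //= mxE enum_rankK_in // eqxx mul1r.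
rewrite big1 ?addr0 // => k ki; rewrite mxE; case: eqP => [E|]; last by rewrite mul0r.
by case/eqP: ki; apply: enum_val_inj; rewrite enum_rankK_in.
Qed.

Lemma selmx_adj T : (selmx T)^t* = (selmx T)^T.
Proof. by apply/matrixP=> i j; rewrite !mxE conj_Creal // realn. Qed.

Lemma selmx_dot T U (i : 'I_#|T|) (j : 'I_#|U|) : T \subset S -> U \subset S ->
  (selmx T *m (selmx U)^t*) i j = (enum_val i == enum_val j)%:R.
Proof.
move=> /subsetP TS _; have h := TS _ (enum_valP i).
by rewrite selmx_adj (selmxM _ _ h) !mxE enum_rankK_in // eq_sym.
Qed.

Lemma selmx_quad T U (i : 'I_#|T|) (j : 'I_#|U|) : T \subset S -> U \subset S ->
  (selmx T *m A S *m (selmx U)^t*) i j = (e (enum_val i) (enum_val j))%:R.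
Proof.
case: sg => esym _ /subsetP TS /subsetP US.
have h := TS _ (enum_valP i); have h' := US _ (enum_valP j).
rewrite selmx_adj -mulmxA (selmxM _ _ h) -[A S *m _]trmxK trmx_mul trmxK mxE.
by rewrite (selmxM _ _ h') !mxE !enum_rankK_in.
Qed.

End Selection.

Lemma rayleigh_root S a : (forall x, root (chi e algR S) x -> x <= a) ->
  forall w : 'rV_#|S|, (w *m A S *m w^t*) 0 0 <= algRval a * (w *m w^t*) 0 0.
Proof.
have [s [sE dE]] := chi_spectrum S; move=> ha w.
apply: (rayleigh_le (adjmx_herm S)) => [|i]; first exact: algRvalP.
have : spectral_diag (A S) 0 i \in map algRval s.
  by rewrite dE; apply/mapP; exists i; rewrite ?mem_enum.
case/mapP=> x xs -> ax; have := ha x; rewrite sE root_prod_XsubC => /(_ xs).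
by rewrite -[x <= a]/(algRval x <= algRval a) => /le_lt_trans/(_ ax); rewrite ltxx.
Qed.

Lemma eigenvector_chi T x : root (chi e algR T) x ->
  exists2 v : 'rV[C]_#|T|, v *m A T = algRval x *: v & 0 < (v *m v^t*) 0 0.
Proof.
move=> rx; have /eigenvalueP[v vE v0] : is_eigenvalue e T (algRval x).
  by apply/eigenvalue_chi; exists x.
by exists v => //; have := dotmx_is_dotmx v0; rewrite dotmxE.
Qed.

(** An eigenvector of [T] extended by zero keeps its norm and its quadratic form, so the Rayleigh
    bound of [S] applies to it. *)
Lemma roots_le_sub T S a : T \subset S ->
  (forall x, root (chi e algR S) x -> x <= a) ->
  forall x, root (chi e algR T) x -> x <= a.
Proof.
move=> TS ha x /eigenvector_chi[v vE v0].
have := rayleigh_root ha (v *m selmx S T).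
have -> : v *m selmx S T *m A S *m (v *m selmx S T)^t* = v *m A T *m v^t*.
  rewrite trmxC_mul !mulmxA -(mulmxA v) -(mulmxA v); congr (v *m _ *m _).
  by apply/matrixP=> i j; rewrite selmx_quad // mxE.
have -> : v *m selmx S T *m (v *m selmx S T)^t* = v *m v^t*.
  rewrite trmxC_mul !mulmxA -(mulmxA v) (_ : selmx S T *m (selmx S T)^t* = 1%:M) ?mulmx1 //.
  by apply/matrixP=> i j; rewrite selmx_dot // mxE (inj_eq enum_val_inj).
by rewrite vE -scalemxAl scalemxE ler_pM2r.
Qed.

(* If only one eigenvalue exceeded [a], a combination of the two extended
   eigenvectors orthogonal to it would violate the Rayleigh bound. *)
Lemma two_roots_gt S T U a x y s : T \subset S -> U \subset S -> [disjoint T & U] ->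
  (forall u v, u \in T -> v \in U -> ~~ e u v) ->
  root (chi e algR T) x -> root (chi e algR U) y -> a < x -> a < y ->
  chi e algR S = \prod_(l <- s) ('X - l%:P) -> (1 < count (fun l => a < l)%R s)%N.
Proof.
move=> TS US dTU noe /eigenvector_chi[v vE v0] /eigenvector_chi[v' v'E v'0] ax ay.
have [s' [-> dE]] := chi_spectrum S => /prod_XsubC_eq/permP/(_ (fun l => a < l)%R) <-.
have cE : count (fun l => a < l)%R s' = #|[pred i | algRval a < spectral_diag (A S) 0 i]|.
  rewrite -(count_map algRval (fun l => algRval a < l)) dE count_map.
  by rewrite -size_filter [RHS]cardE enumT; congr size; rewrite [RHS]/enum_mem; apply: eq_filter.
rewrite cE ltnNge; apply/negP => c1.
pose w := v *m selmx S T; pose w' := v' *m selmx S U.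
set P := spectralmx (A S).
(* By [c1] at most one index has an eigenvalue above [a]; [k] holds the coordinates of [w] and [w']
   there, or (0, 0) if there is no such index. *)
have [k kP] : exists y, forall i, algRval a < spectral_diag (A S) 0 i ->
    (w *m P^t*) 0 i = y.1 /\ (w' *m P^t*) 0 i = y.2.
  have [/existsP[k ak]|] := boolP [exists i, algRval a < spectral_diag (A S) 0 i].
    exists ((w *m P^t*) 0 k, (w' *m P^t*) 0 k) => i ai.
    by have /card_le1_eqP/(_ i k ai ak) -> := c1.
  by move=> /existsPn h; exists (0, 0) => i ai; case/negP: (h i).
(* Coefficients of a nontrivial combination that is orthogonal to that one eigenvector. *)
have [c [c0 ck]] : exists c : C * C, (c != 0) /\ c.1 * k.1 + c.2 * k.2 = 0.
  have [k0|k0] := eqVneq k 0.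
    by exists (1, 0); rewrite k0 /= mulr0 mul0r addr0 xpair_eqE oner_eq0.
  exists (k.2, - k.1); split; last by rewrite /=; ring.
  by move: k0; case: (k) => k1 k2 /=; rewrite !xpair_eqE oppr_eq0 andbC.
pose z := c.1 *: w + c.2 *: w'.
have dot (T1 T2 : {set V}) (u1 : 'rV_#|T1|) (u2 : 'rV_#|T2|) :
    (u1 *m selmx S T1) *m (u2 *m selmx S T2)^t* =
    u1 *m (selmx S T1 *m (selmx S T2)^t*) *m u2^t* by rewrite trmxC_mul !mulmxA.
have quad (T1 T2 : {set V}) (u1 : 'rV_#|T1|) (u2 : 'rV_#|T2|) :
    (u1 *m selmx S T1) *m A S *m (u2 *m selmx S T2)^t* =
    u1 *m (selmx S T1 *m A S *m (selmx S T2)^t*) *m u2^t* by rewrite trmxC_mul !mulmxA.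
have neq u1 u2 : u1 \in T -> u2 \in U -> (u1 == u2) = false.
  by move=> u1T u2U; apply/eqP => E; rewrite -E (disjointFr dTU u1T) in u2U.
have d11 : w *m w^t* = v *m v^t*.
  rewrite dot (_ : _ *m (selmx S T)^t* = 1%:M) ?mulmx1 //.
  by apply/matrixP=> i j; rewrite selmx_dot // mxE (inj_eq enum_val_inj).
have d22 : w' *m w'^t* = v' *m v'^t*.
  rewrite dot (_ : _ *m (selmx S U)^t* = 1%:M) ?mulmx1 //.
  by apply/matrixP=> i j; rewrite selmx_dot // mxE (inj_eq enum_val_inj).
have d12 : w *m w'^t* = 0.
  rewrite dot (_ : _ *m (selmx S U)^t* = 0) ?mulmx0 ?mul0mx //.
  by apply/matrixP=> i j; rewrite selmx_dot // mxE neq ?enum_valP.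
have d21 : w' *m w^t* = 0 by rewrite -[w']trmxC_K -trmxC_mul d12 trmx0 map_mx0.
have q11 : w *m A S *m w^t* = algRval x *: (v *m v^t*).
  rewrite quad scalemxAl -vE; congr (_ *m _ *m _).
  by apply/matrixP=> i j; rewrite selmx_quad // mxE.
have q22 : w' *m A S *m w'^t* = algRval y *: (v' *m v'^t*).
  rewrite quad scalemxAl -v'E; congr (_ *m _ *m _).
  by apply/matrixP=> i j; rewrite selmx_quad // mxE.
have q12 : w *m A S *m w'^t* = 0.
  rewrite quad (_ : _ *m (selmx S U)^t* = 0) ?mulmx0 ?mul0mx //.
  by apply/matrixP=> i j; rewrite selmx_quad // mxE (negPf (noe _ _ _ _)) ?enum_valP.
have q21 : w' *m A S *m w^t* = 0.
  rewrite quad (_ : _ *m (selmx S T)^t* = 0) ?mulmx0 ?mul0mx //.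
  apply/matrixP=> i j; rewrite selmx_quad // mxE; case: sg => -> _.
  by rewrite (negPf (noe _ _ _ _)) ?enum_valP.
have zT : z^t* = (c.1)^* *: w^t* + (c.2)^* *: w'^t*.
  by apply/matrixP=> i j; rewrite !mxE rmorphD !rmorphM.
have zz : (z *m z^t*) 0 0 = `|c.1| ^+ 2 * (v *m v^t*) 0 0 + `|c.2| ^+ 2 * (v' *m v'^t*) 0 0.
  rewrite zT /z mulmxDl !mulmxDr -!(scalemxAl, scalemxAr) d11 d22 d12 d21.
  by rewrite !scaler0 addr0 add0r addmxE !scalemxE !normCK !mulrA.
have zAz : (z *m A S *m z^t*) 0 0 = algRval x * (`|c.1| ^+ 2 * (v *m v^t*) 0 0)
      + algRval y * (`|c.2| ^+ 2 * (v' *m v'^t*) 0 0).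
  rewrite zT /z !mulmxDl !mulmxDr -!(scalemxAl, scalemxAr) q11 q22 q12 q21.
  by rewrite !scaler0 addr0 add0r addmxE !scalemxE !normCK; ring.
have ra : algRval a \is Num.real by apply: algRvalP.
have zP i : algRval a < spectral_diag (A S) 0 i -> (z *m P^t*) 0 i = 0.
  case/kP=> k1 k2; rewrite mulmxDl -!scalemxAl addmxE !scalemxE.
  by rewrite [X in _ * X + _]k1 [X in _ + _ * X]k2.
have := rayleigh_le (adjmx_herm S) ra zP; rewrite zz zAz mulrDr.
set n1 := _ ^+ 2 * _; set n2 := _ ^+ 2 * _; apply/negP/negbT/lt_geF.
have n1_ge0 : 0 <= n1 by rewrite mulr_ge0 ?exprn_ge0 // ltW.
have n2_ge0 : 0 <= n2 by rewrite mulr_ge0 ?exprn_ge0 // ltW.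
(* Some coefficient is nonzero, and its summand makes the quadratic form strictly larger than the
   Rayleigh bound. *)
have [c1z|c1n] := eqVneq c.1 0.
  have c2n : c.2 != 0 by move: c0; rewrite (surjective_pairing c) c1z xpair_eqE eqxx.
  have n2p : 0 < n2 by rewrite mulr_gt0 // exprn_gt0 // normr_gt0.
  by apply: ler_ltD; [rewrite ler_wpM2r // ltW | rewrite ltr_pM2r].
have n1p : 0 < n1 by rewrite mulr_gt0 // exprn_gt0 // normr_gt0.
by apply: ltr_leD; [rewrite ltr_pM2r | rewrite ler_wpM2r // ltW].
Qed.

End Interlacing.

(** * Trees and their branches *)

Section Trees.
Variables (V : finType) (e : rel V).
Hypothesis sg : simple_graph e.
Implicit Types (S T U C : {set V}) (r u v w x y : V).
Local Open Scope nat_scope.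

Let esym : symmetric e. Proof. by case: sg. Qed.
Let eirr : irreflexive e. Proof. by case: sg. Qed.

Lemma restrS_connect_sym S : connect_sym (restrS e S).
Proof.
by apply: sym_connect_sym => x y; rewrite /restrS /= esym; case: (x \in S); rewrite ?andbF.
Qed.

Lemma tcomp_id S u : u \in tcomp e S u.
Proof. by rewrite inE. Qed.

Lemma tcomp_sub S u : u \in S -> tcomp e S u \subset S.
Proof.
move=> uS; apply/subsetP=> y; rewrite inE => cuy.
rewrite -(closed_connect (e := restrS e S) (a := mem S) _ cuy) //.
by apply: intro_closed; [exact: restrS_connect_sym | move=> x z /and3P[]].
Qed.

Lemma tcomp_eq S u v : v \in tcomp e S u -> tcomp e S v = tcomp e S u.
Proof.
rewrite inE => cuv; apply/setP=> y; rewrite !inE.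
by rewrite -(same_connect (@restrS_connect_sym S) cuv).
Qed.

Lemma tcomp_edge S u x y : x \in S -> y \in S -> e x y ->
  x \in tcomp e S u -> y \in tcomp e S u.
Proof.
move=> xS yS exy; rewrite !inE => /connect_trans; apply; apply: connect1.
by rewrite /restrS /= xS yS.
Qed.

Lemma tcomp_mono S S' u : S \subset S' -> tcomp e S u \subset tcomp e S' u.
Proof.
move=> /subsetP sub; apply/subsetP=> y; rewrite !inE; apply: connect_sub => x z.
by case/and3P=> /sub xS /sub zS exz; apply: connect1; rewrite /restrS /= xS zS.
Qed.

Lemma tcomp_restrict S S' u : S' \subset S -> tcomp e S u \subset S' ->
  tcomp e S u \subset tcomp e S' u.
Proof.
move=> S'S sub; apply/subsetP=> y; rewrite inE => cuy.
rewrite -(closed_connect (e := restrS e S) (a := mem (tcomp e S' u)) _ cuy) ?tcomp_id //.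
apply: intro_closed; first exact: restrS_connect_sym.
move=> x z /and3P[xS zS exz] xC.
have xC' := subsetP (tcomp_mono u S'S) _ xC.
apply: (tcomp_edge _ _ exz xC); apply: (subsetP sub) => //.
exact: (tcomp_edge _ _ exz xC').
Qed.

Lemma tcomp_connected S u : u \in S -> connectedS e (tcomp e S u).
Proof.
move=> uS x y xC yC; have := tcomp_eq xC => E.
have := tcomp_restrict (S := S) (S' := tcomp e S u) (u := x) (tcomp_sub uS).
by rewrite E => /(_ (subxx _))/subsetP/(_ _ yC); rewrite inE.
Qed.

Lemma tcomp_cover S r y : connectedS e S -> r \in S -> y \in S -> y != r ->
  exists2 u, (u \in S) && e r u & y \in tcomp e (S :\ r) u.
Proof.
move=> cS rS yS yr.
pose B : pred V := [pred y | (y == r) ||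
  [exists u, [&& u \in S, e r u & y \in tcomp e (S :\ r) u]]].
have : y \in B.
  rewrite -(closed_connect (e := restrS e S) (a := B) _ (cS _ _ rS yS)) ?inE ?eqxx //.
  apply: intro_closed; first exact: restrS_connect_sym.
  move=> x z /and3P[xS zS exz]; rewrite !inE; case: (z =P r) => //= zr.
  case: (x =P r) => [xr _|xr /existsP[u /and3P[uS eru xu]]]; apply/existsP.
    by exists z; rewrite zS -xr exz tcomp_id.
  exists u; rewrite uS eru /=; apply: tcomp_edge exz xu; rewrite !inE.
    by rewrite xS andbT; apply/eqP.
  by rewrite zS andbT; apply/eqP.
by rewrite !inE (negPf yr) /= => /existsP[u /and3P[uS eru yu]]; exists u; rewrite ?uS.
Qed.

(** Each edge is counted twice, which keeps the arithmetic free of the halving in [nedges]. *)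
Definition edge_sum S := \sum_(x in S) \sum_(y in S) e x y.

Lemma nedgesE S : nedges e S = (edge_sum S)./2.
Proof.
rewrite /nedges -sum1_card /edge_sum; congr _./2.
rewrite pair_big_dep /= big_mkcond [RHS]big_mkcond /=; apply: eq_bigr => p _.
by rewrite inE /restrS /=; do 2!case: (_ \in S) => //=; case: (e _ _).
Qed.

Lemma edge_sumD1 S r : r \in S ->
  edge_sum S = (\sum_(y in S) e r y).*2 + edge_sum (S :\ r).
Proof.
move=> rS; have dE : \sum_(y in S) e r y = \sum_(y in S :\ r) e r y.
  by rewrite (big_setD1 r) //= eirr.
rewrite /edge_sum (big_setD1 r) //= dE -addnn -addnA; congr (_ + _).
rewrite -big_split /=; apply: eq_bigr => x _.
by rewrite (big_setD1 r) //= esym.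
Qed.

Lemma edge_sum_even S : ~~ odd (edge_sum S).
Proof.
have [n] := ubnP #|S|; elim: n S => // n IH S sS.
have [->|[r rS]] := set_0Vmem S; first by rewrite /edge_sum big_set0.
rewrite (edge_sumD1 rS) oddD odd_double IH //.
by move: sS; rewrite (cardsD1 r) rS.
Qed.

Definition nbrs S r : {set V} := [set u in S | e r u].
(** As an image, this lists a component once even when several neighbours of [r] lie in it;
    [tree_comps] excludes that case for trees. *)
Definition comps S r : {set {set V}} := tcomp e (S :\ r) @: nbrs S r.

Lemma nbrs_D1 S r u : u \in nbrs S r -> u \in S :\ r.
Proof.
rewrite !inE => /andP[uS eru]; rewrite uS andbT; apply/eqP=> E.
by move: eru; rewrite E eirr.
Qed.

Lemma comps_partition S r : connectedS e S -> r \in S -> partition (comps S r) (S :\ r).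
Proof.
move=> cS rS; apply/and3P; split.
- apply/eqP/setP=> y; apply/bigcupP/idP => [[C /imsetP[u uN ->]]|].
    exact/subsetP/tcomp_sub/nbrs_D1.
  rewrite !inE => /andP[yr yS]; have [u uN yu] := tcomp_cover cS rS yS yr.
  by exists (tcomp e (S :\ r) u) => //; apply: imset_f; rewrite inE.
- apply/trivIsetP=> _ _ /imsetP[u uN ->] /imsetP[w wN ->]; apply: contraR.
  rewrite -setI_eq0 => /set0Pn[y]; rewrite !inE => /andP[yu yw].
  have /tcomp_eq <- : y \in tcomp e (S :\ r) u by rewrite inE.
  by apply/eqP/tcomp_eq; rewrite inE.
- by apply/imsetP=> -[u _ E]; have := tcomp_id (S :\ r) u; rewrite -E inE.
Qed.

Lemma edge_sum_comps S r : connectedS e S -> r \in S ->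
  edge_sum (S :\ r) = \sum_(C in comps S r) edge_sum C.
Proof.
move=> cS rS; have /and3P[/eqP cov tI _] := comps_partition cS rS.
rewrite /edge_sum -{1}cov big_trivIset //=; apply: eq_bigr => C CP.
apply: eq_bigr => x xC; case/imsetP: CP => u uN CE.
have sub : C \subset S :\ r by rewrite CE; apply/tcomp_sub/nbrs_D1.
rewrite (big_setID C) /= [X in _ + X]big1 ?addn0; last first.
  move=> y; rewrite inE => /andP[yC yS]; case exy : (e x y) => //.
  case/negP: yC; rewrite CE; apply: tcomp_edge exy _ => //; last by rewrite -CE.
  exact: (subsetP sub).
by rewrite (setIidPr sub).
Qed.

Lemma card_comps_sum S r : connectedS e S -> r \in S ->
  \sum_(C in comps S r) #|C| = #|S|.-1.
Proof.
move=> cS rS; rewrite -(card_partition (comps_partition cS rS)).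
by rewrite [in RHS](cardsD1 r) rS.
Qed.

Lemma comps_le_deg S r : #|comps S r| <= \sum_(y in S) e r y.
Proof.
have -> : \sum_(y in S) e r y = #|nbrs S r|.
  rewrite -sum1_card big_mkcond [RHS]big_mkcond; apply: eq_bigr => y _.
  by rewrite inE; case: (y \in S) => //=; case: (e r y).
exact: leq_imset_card.
Qed.

Lemma comp_connected S r C : C \in comps S r -> connectedS e C /\ 0 < #|C|.
Proof.
case/imsetP=> u uN ->; split; first exact/tcomp_connected/nbrs_D1.
by apply/card_gt0P; exists u; apply: tcomp_id.
Qed.

(** A connected graph has at least #|S| - 1 edges: deleting [r] removes deg(r) edges and leaves at
    most deg(r) components, to which induction applies. *)
Lemma edge_sum_ge S : connectedS e S -> 0 < #|S| -> #|S|.*2 <= edge_sum S + 2.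
Proof.
have [n] := ubnP #|S|; elim: n S => // n IH S sS cS /card_gt0P[r rS].
rewrite (edge_sumD1 rS) (edge_sum_comps cS rS).
have h : (\sum_(C in comps S r) #|C|).*2 <= \sum_(C in comps S r) (edge_sum C + 2).
  rewrite -mul2n big_distrr /=; apply: leq_sum => C CP; rewrite mul2n.
  have [cC C0] := comp_connected CP; apply: IH => //.
  rewrite -ltnS; apply: leq_trans sS; rewrite !ltnS (cardsD1 r S) rS ltnS; apply: subset_leq_card.
  by case/imsetP: CP => u uN ->; apply/tcomp_sub/nbrs_D1.
rewrite card_comps_sum // big_split /= sum_nat_const in h.
have := comps_le_deg S r; have : 0 < #|S| by apply/card_gt0P; exists r.
move: h; set a := \sum_(_ in _) edge_sum _; set d := \sum_(_ in _) _.
move: #|S| #|comps S r| a d; lia.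
Qed.

Lemma is_tree_edge_sum S : is_tree e S <->
  [/\ S != set0, connectedS e S & edge_sum S + 2 = #|S|.*2].
Proof.
rewrite /is_tree nedgesE; have := edge_sum_even S.
split=> [[S0 [cS E]]|[S0 cS E]]; split=> //; have := S0; rewrite -card_gt0 => ?; first by lia.
by split=> //; lia.
Qed.

(** A tree attains equality in [edge_sum_ge], which forces equality both in [comps_le_deg] and in
    the bound for each component. *)
Lemma tree_comps S r : is_tree e S -> r \in S ->
  {in nbrs S r &, injective (tcomp e (S :\ r))} /\
  (forall C, C \in comps S r -> is_tree e C).
Proof.
move=> /is_tree_edge_sum[S0 cS E] rS; move: E.
rewrite (edge_sumD1 rS) (edge_sum_comps cS rS) => E.
have deg := comps_le_deg S r.
have ge C : C \in comps S r -> #|C|.*2 <= edge_sum C + 2.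
  by case/comp_connected=> cC C0; apply: edge_sum_ge.
have sumE := card_comps_sum cS rS.
have h (B : {set {set V}}) : B \subset comps S r ->
    (\sum_(C in B) #|C|).*2 <= \sum_(C in B) edge_sum C + #|B| * 2.
  move/subsetP=> sB; rewrite -mul2n big_distrr /= -sum_nat_const -big_split /=.
  by apply: leq_sum => C CB; rewrite mul2n ge // sB.
have := h _ (subxx _); rewrite sumE => hT.
have S1 : 0 < #|S| by rewrite card_gt0.
split.
  apply/imset_injP; rewrite eqn_leq leq_imset_card /= -/(comps S r).
  have -> : #|nbrs S r| = \sum_(y in S) e r y.
    rewrite -sum1_card big_mkcond [RHS]big_mkcond; apply: eq_bigr => y _.
    by rewrite inE; case: (y \in S) => //=; case: (e r y).
  move: hT E deg S1; set a := \sum_(_ in _) edge_sum _; set d := \sum_(_ in _) _.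
  move: #|S| #|comps S r| a d; lia.
move=> C CP; apply/is_tree_edge_sum; have [cC C0] := comp_connected CP.
split=> //; first by rewrite -card_gt0.
have := h _ (subD1set _ C); move: hT E sumE deg (ge C CP).
rewrite (cardsD1 C (comps S r)) CP !(big_setD1 C CP) /=.
move: S1 C0; set a := \sum_(_ in _) #|_|; set b := \sum_(_ in _) edge_sum _.
set d := \sum_(_ in _) _; move: (edge_sum C) a b d #|S| #|C| #|comps S r :\ C|; lia.
Qed.

Lemma tcomp_tree S r u : is_tree e S -> r \in S -> u \in S -> e r u ->
  is_tree e (tcomp e (S :\ r) u).
Proof.
by move=> tS rS uS eru; apply: (tree_comps tS rS).2; apply: imset_f; rewrite inE uS.
Qed.

Lemma tcomp_nbr S r u w : is_tree e S -> r \in S -> u \in S -> e r u ->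
  w \in S -> e r w -> w \in tcomp e (S :\ r) u -> w = u.
Proof.
move=> tS rS uS eru wS erw /tcomp_eq; apply: (tree_comps tS rS).1; by rewrite inE ?wS ?uS.
Qed.

Lemma tcomp_D1_sub S r u : r \in S -> u \in S -> e r u -> tcomp e (S :\ r) u \subset S :\ r.
Proof. by move=> rS uS eru; apply/tcomp_sub/nbrs_D1; rewrite inE uS. Qed.

Lemma tcomp_disjoint S r u w : is_tree e S -> r \in S -> u \in S -> e r u ->
  w \in S -> e r w -> u != w -> [disjoint tcomp e (S :\ r) u & tcomp e (S :\ r) w].
Proof.
move=> tS rS uS eru wS erw uw; rewrite -setI_eq0; apply/set0Pn=> -[y]; rewrite inE.
case/andP=> /tcomp_eq E1 /tcomp_eq E2; case/eqP: uw.
by apply: (tcomp_nbr tS rS wS erw uS eru); rewrite -E2 E1 tcomp_id.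
Qed.

Lemma tcomp_no_edge S r u w x y : is_tree e S -> r \in S -> u \in S -> e r u ->
  w \in S -> e r w -> u != w -> x \in tcomp e (S :\ r) u -> y \in tcomp e (S :\ r) w ->
  ~~ e x y.
Proof.
move=> tS rS uS eru wS erw uw xu yw; apply/negP => exy.
have := tcomp_disjoint tS rS uS eru wS erw uw => /disjointFl/(_ yw)/negP; apply.
apply: (tcomp_edge _ _ exy xu).
  exact: (subsetP (tcomp_D1_sub rS uS eru)).
exact: (subsetP (tcomp_D1_sub rS wS erw)).
Qed.

(* The branch at another neighbour avoids [u], hence survives its deletion. *)
Lemma tcomp_sub_tcomp S r u w : is_tree e S -> r \in S -> u \in S -> e r u ->
  w \in S -> e r w -> w != u -> tcomp e (S :\ r) w \subset tcomp e (S :\ u) r.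
Proof.
move=> tS rS uS eru wS erw wu; apply/subsetP=> y yw.
have wD : tcomp e (S :\ r) w \subset (S :\ r) :\ u.
  apply/subsetP=> z zw; rewrite in_setD1 (subsetP (tcomp_D1_sub rS wS erw)) // andbT.
  apply: contraNneq wu => zu; rewrite eq_sym; apply/eqP.
  by apply: (tcomp_nbr tS rS wS erw uS eru); rewrite -zu.
have sub : (S :\ r) :\ u \subset S :\ u by apply: setSD; apply: subD1set.
have yw' := subsetP (subset_trans (tcomp_restrict (subD1set _ _) wD) (tcomp_mono w sub)) _ yw.
have ru : r != u by apply: contraTneq eru => ->; rewrite eirr.
suff /tcomp_eq <- : w \in tcomp e (S :\ u) r by [].
by apply: tcomp_edge erw (tcomp_id _ _); rewrite !inE ?rS ?wS ?ru ?wu.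
Qed.

(** A vertex on both sides would be reached from [r] through a neighbour other than [u], hence would
    lie in two branches at [r]. *)
Lemma tree_edge_split S r u : is_tree e S -> r \in S -> u \in S -> e r u ->
  is_join e (tcomp e (S :\ u) r) r (tcomp e (S :\ r) u) u S.
Proof.
move=> tS rS uS eru; have eur : e u r by rewrite esym.
have cS : connectedS e S by case: tS => _ [].
have ru : r != u by apply: contraTneq eru => ->; rewrite eirr.
have sub1 := tcomp_D1_sub uS rS eur; have sub2 := tcomp_D1_sub rS uS eru.
have dis : [disjoint tcomp e (S :\ u) r & tcomp e (S :\ r) u].
  rewrite -setI_eq0; apply/set0Pn=> -[y]; rewrite in_setI => /andP[y1 y2].
  have yr : y != r by have := subsetP sub2 _ y2; rewrite !inE => /andP[].
  have rD : r \in S :\ u by rewrite !inE ru.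
  have [w /andP[wC erw] yw] :=
    tcomp_cover (tcomp_connected rD) (tcomp_id _ _) y1 yr.
  have := subsetP sub1 _ wC; rewrite !inE => /andP[wu wS].
  have sub3 : tcomp e (S :\ u) r :\ r \subset S :\ r.
    by apply: setSD; apply: subset_trans sub1 (subD1set _ _).
  have yw' := subsetP (tcomp_mono w sub3) _ yw.
  by have := disjointFr (tcomp_disjoint tS rS wS erw uS eru wu) yw'; rewrite y2.
split=> //; try exact: tcomp_id.
- apply/setP=> y; rewrite in_setU; apply/idP/orP => [yS|[]]; last first.
  + by move/(subsetP sub2); rewrite inE => /andP[].
  + by move/(subsetP sub1); rewrite inE => /andP[].
  have [->|yr] := eqVneq y r; first by left; apply: tcomp_id.
  have [w /andP[wS erw] yw] := tcomp_cover cS rS yS yr.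
  have [<-|wu] := eqVneq w u; [by right|left].
  exact: (subsetP (tcomp_sub_tcomp tS rS uS eru wS erw wu)).
move=> x y x1 y2; apply/idP/andP => [exy|[/eqP-> /eqP->] //].
have /setD1P[yr yS] := subsetP sub2 _ y2.
have /setD1P[xu xS] := subsetP sub1 _ x1.
have [xr|xr] := eqVneq x r; last first.
  have x2 : x \in tcomp e (S :\ r) u.
    by apply: tcomp_edge (y2); rewrite 1?esym // !inE ?yr ?xr.
  by rewrite (disjointFr dis x1) in x2.
split=> //; apply/eqP; apply: (tcomp_nbr tS rS uS eru) => //.
by rewrite -xr.
Qed.

Lemma join_tree S1 r1 S2 r2 S : is_tree e S1 -> is_tree e S2 ->
  is_join e S1 r1 S2 r2 S -> is_tree e S.
Proof.
move=> /is_tree_edge_sum[S10 c1 E1] /is_tree_edge_sum[S20 c2 E2] [dis SE r1S r2S eE].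
have dis' : [disjoint S2 & S1] by rewrite disjoint_sym.
apply/is_tree_edge_sum; split.
- by rewrite SE; apply/set0Pn; exists r1; rewrite inE r1S.
- have s1 : S1 \subset S by rewrite SE subsetUl.
  have s2 : S2 \subset S by rewrite SE subsetUr.
  suff h z : z \in S -> connect (restrS e S) r1 z.
    by move=> x y xS yS; apply: connect_trans (h y yS); rewrite restrS_connect_sym h.
  rewrite SE in_setU => /orP[z1|z2].
    have : z \in tcomp e S1 r1 by rewrite inE c1.
    by move/(subsetP (tcomp_mono r1 s1)); rewrite inE SE.
  have : z \in tcomp e S2 r2 by rewrite inE c2.
  move/(subsetP (tcomp_mono r2 s2)); rewrite inE -SE; apply: connect_trans.
  by apply: connect1; rewrite /restrS /= (subsetP s1) // (subsetP s2) // eE // !eqxx.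
have sumU (F : V -> nat) : \sum_(x in S) F x = \sum_(x in S1) F x + \sum_(x in S2) F x.
  by rewrite SE -bigU //=; apply: eq_bigl => x; rewrite inE.
have c12 : \sum_(x in S1) \sum_(y in S2) e x y = 1.
  rewrite (big_setD1 r1) //= (big_setD1 r2) //= eE // !eqxx /=.
  rewrite !big1 // => [x|y]; rewrite !inE => /andP[h1 h2].
    by apply: big1 => y y2; rewrite eE // (negPf h1).
  by rewrite eE // (negPf h1) andbF.
have -> : edge_sum S = edge_sum S1 + edge_sum S2 + 2.
  rewrite /edge_sum sumU; under eq_bigr => x _ do rewrite sumU.
  under [X in _ + X]eq_bigr => x _ do rewrite sumU.
  rewrite !big_split /= [X in _ + (X + _)]exchange_big /=.
  under [X in _ + (X + _)]eq_bigr => x _ do under eq_bigr => y _ do rewrite esym.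
  by rewrite c12; lia.
have -> : #|S| = #|S1| + #|S2|.
  by rewrite SE cardsU (disjoint_setI0 dis) cards0 subn0.
by move: E1 E2; move: (edge_sum S1) (edge_sum S2) #|S1| #|S2|; lia.
Qed.

Lemma join_bipartite S1 r1 S2 r2 S : bipartite e S1 -> bipartite e S2 ->
  is_join e S1 r1 S2 r2 S -> bipartite e S.
Proof.
move=> [c1 h1] [c2 h2] [dis -> r1S r2S eE].
exists (fun x => if x \in S1 then c1 x (+) c1 r1 else ~~ (c2 x (+) c2 r2)).
move=> x y; rewrite /restrS /= !inE.
have [x1|x1] := boolP (x \in S1); have [y1|y1] := boolP (y \in S1) => /=.
- by move=> exy; have := h1 x y; rewrite /restrS /= x1 y1 exy => /(_ isT); do 3!case: (c1 _).
- by case/andP=> y2; rewrite eE // => /andP[/eqP-> /eqP->]; rewrite !addbb.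
- case/andP=> x2; rewrite esym eE // => /andP[/eqP-> /eqP->]; by rewrite !addbb.
- case/and3P=> x2 y2 exy; have := h2 x y; rewrite /restrS /= x2 y2 exy => /(_ isT).
  by do 3!case: (c2 _).
Qed.

Lemma tree_bipartite S : is_tree e S -> bipartite e S.
Proof.
have [n] := ubnP #|S|; elim: n S => // n IH S sS tS.
have [S0 [cS _]] := tS; have /set0Pn[r rS] := S0.
have [/existsP[y /andP[yS yr]]|] := boolP [exists y, (y \in S) && (y != r)]; last first.
  move/existsPn=> h; exists xpredT => x y /and3P[xS yS exy].
  have := h x; rewrite xS /= negbK => /eqP xr; have := h y; rewrite yS /= negbK => /eqP yr.
  by move: exy; rewrite xr yr eirr.
have [u /andP[uS eru] _] := tcomp_cover cS rS yS yr.
have eur : e u r by rewrite esym.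
have lt v w : v \in S -> w \in S -> e v w -> #|tcomp e (S :\ v) w| < n.
  move=> vS wS evw; rewrite -ltnS; apply: leq_trans sS; rewrite ltnS (cardsD1 v S) vS ltnS.
  exact/subset_leq_card/tcomp_D1_sub.
apply: join_bipartite (tree_edge_split tS rS uS eru); apply: IH; try exact: lt.
  exact: tcomp_tree.
exact: tcomp_tree.
Qed.

Lemma rooted_tree_ind (P : {set V} -> V -> Prop) :
  (forall S r, is_tree e S -> r \in S ->
     (forall u, u \in S -> e r u -> P (tcomp e (S :\ r) u) u) -> P S r) ->
  forall S r, is_tree e S -> r \in S -> P S r.
Proof.
move=> step S r; have [n] := ubnP #|S|; elim: n S r => // n IH S r sS tS rS.
apply: step => // u uS eru; apply: IH; last exact: tcomp_id.
  rewrite -ltnS; apply: leq_trans sS; rewrite ltnS (cardsD1 r S) rS ltnS.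
  exact/subset_leq_card/tcomp_D1_sub.
exact: tcomp_tree.
Qed.

(** * Expansion of the characteristic polynomial at the root *)

Section Star.
Variables (F : fieldType) (S : {set V}) (r : V).
Hypotheses (tS : is_tree e S) (rS : r \in S).
Local Notation T u := (tcomp e (S :\ r) u).
Local Open Scope ring_scope.

(** The root with only some of its branches, so that branches can be attached one at a time, each by
    [chi_join]. *)
Let star (us : seq V) := r |: \bigcup_(u <- us) T u.

Lemma setD1_bigcup : S :\ r = \bigcup_(u <- enum (nbrs S r)) T u.
Proof.
have cS : connectedS e S by case: tS => _ [].
rewrite bigcup_seq; apply/setP=> y; apply/idP/bigcupP => [|[u]].
  rewrite !inE => /andP[yr yS]; have [u uN yu] := tcomp_cover cS rS yS yr.
  by exists u => //; rewrite mem_enum inE.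
by rewrite mem_enum => /nbrs_D1 uN /(subsetP (tcomp_sub uN)).
Qed.

Let chi_bigcup_nbrs us : uniq us -> {subset us <= nbrs S r} ->
  chi e F (\bigcup_(u <- us) T u) = \prod_(u <- us) chi e F (T u).
Proof.
move=> uq sub; apply: chi_bigcup => // u w /sub/setIdP[uS eru] /sub/setIdP[wS erw] uw.
split; first exact: tcomp_disjoint.
by move=> x y; apply: tcomp_no_edge.
Qed.

Lemma chi_D1 : chi e F (S :\ r) = \prod_(u in S | e r u) chi e F (T u).
Proof.
rewrite {1}setD1_bigcup chi_bigcup_nbrs ?enum_uniq //; last by move=> u; rewrite mem_enum.
by rewrite big_enum /=; apply: eq_bigl => u; rewrite inE.
Qed.

Lemma star_join u us : uniq (u :: us) -> {subset u :: us <= nbrs S r} ->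
  is_join e (star us) r (T u) u (star (u :: us)).
Proof.
move=> /= /andP[uus uq] sub; have /setIdP[uS eru] := sub _ (mem_head _ _).
have subT w : w \in u :: us -> T w \subset S :\ r by move/sub/nbrs_D1/tcomp_sub.
have inU y : y \in \bigcup_(w <- us) T w ->
    exists w, [/\ w \in S, e r w, w != u & y \in T w].
  rewrite bigcup_seq => /bigcupP[w wus yw]; exists w.
  have /setIdP[wS erw] : w \in nbrs S r by apply: sub; rewrite inE wus orbT.
  by split=> //; apply: contraNneq uus => <-.
have rT : r \notin T u.
  by apply/negP => /(subsetP (subT u (mem_head _ _))); rewrite !inE eqxx.
split.
- rewrite -setI_eq0; apply/set0Pn=> -[y]; rewrite in_setI => /andP[yZ yu].
  move: yZ; rewrite in_setU1 => /orP[/eqP yr|/inU[w [wS erw wu yw]]].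
    by rewrite yr (negPf rT) in yu.
  by have := disjointFr (tcomp_disjoint tS rS wS erw uS eru wu) yw; rewrite yu.
- by rewrite /star big_cons [T u :|: _]setUC setUA.
- by rewrite in_setU1 eqxx.
- exact: tcomp_id.
move=> x y; rewrite in_setU1 => /orP[/eqP->|/inU[w [wS erw wu xw]]] yu.
  rewrite eqxx /=; apply/idP/eqP => [ery|-> //].
  have /setD1P[_ yS] := subsetP (subT u (mem_head _ _)) _ yu.
  exact: (tcomp_nbr tS rS uS eru yS ery yu).
rewrite (negPf (tcomp_no_edge tS rS wS erw uS eru wu xw yu)); symmetry.
have /setD1P[xr _] := subsetP (tcomp_D1_sub rS wS erw) _ xw.
by rewrite (negPf xr).
Qed.

Lemma chi_star us (x : F) : uniq us -> {subset us <= nbrs S r} ->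
  (forall u, u \in us -> (chi e F (T u)).[x] != 0) ->
  (chi e F (star us)).[x] = (\prod_(u <- us) (chi e F (T u)).[x]) *
     (x - \sum_(u <- us) (chi e F (T u :\ u)).[x] / (chi e F (T u)).[x]).
Proof.
elim: us => [|u us IH] uq sub nz.
  by rewrite !big_nil /star big_nil setU0 chi_set1 // hornerX mul1r subr0.
have J := star_join uq sub; case/andP: uq => uus uq.
have subus : {subset us <= nbrs S r} by move=> w wus; apply: sub; rewrite inE wus orbT.
have Zr : star us :\ r = \bigcup_(w <- us) T w.
  apply/setP=> y; rewrite !inE; have [->|] := eqVneq y r => //=.
  symmetry; apply/negbTE; rewrite bigcup_seq.
  apply/bigcupP=> -[w /subus/nbrs_D1/tcomp_sub/subsetP h].
  by move/h; rewrite !inE eqxx.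
rewrite (chi_join F sg J) Zr chi_bigcup_nbrs // hornerD hornerN !hornerM horner_prod.
rewrite IH //; last by move=> w wus; apply: nz; rewrite inE wus orbT.
rewrite !big_cons; have nzu := nz u (mem_head _ _).
by set p := \prod_(_ <- _) _; set s := \sum_(_ <- _) _; field.
Qed.

Lemma chi_root_quotient (x : F) : (chi e F (S :\ r)).[x] != 0 ->
  (chi e F S).[x] = (chi e F (S :\ r)).[x] *
     (x - \sum_(u in S | e r u) (chi e F (T u :\ u)).[x] / (chi e F (T u)).[x]).
Proof.
rewrite chi_D1 horner_prod => nz.
have -> : chi e F S = chi e F (star (enum (nbrs S r))).
  by rewrite /star -setD1_bigcup setD1K.
rewrite chi_star ?enum_uniq //.
- by rewrite !big_enum /=; congr (_ * (_ - _)); apply: eq_bigl => u; rewrite inE.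
- by move=> u; rewrite mem_enum.
move=> u; rewrite mem_enum inE => uN; move: nz.
by rewrite (bigD1 u) //= mulf_eq0 => /norP[].
Qed.

End Star.

End Trees.

(** * Sign changes of split real polynomials *)

Section RealPolynomials.
Variable R : realFieldType.
Implicit Types (p : {poly R}) (s : seq R) (a b x y : R).

(** Substitute for a right limit: p - p(a) is (X - a) times a polynomial bounded near [a], so a
    negative value at [a] would persist just to its right. *)
Lemma poly_ge0_right p a b : a < b ->
  (forall x, a < x -> x < b -> 0 <= p.[x]) -> 0 <= p.[a].
Proof.
move=> ab h; rewrite leNgt; apply/negP => pa.
have /factor_theorem[q qE] : root (p - p.[a]%:P) a.
  by rewrite /root !hornerE subrr.
have [B hB] := poly_disk_bound q (`|a| + `|b|).
have Bge : 0 <= B.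
  apply: le_trans (hB a _); first exact: normr_ge0.
  by rewrite lerDl normr_ge0.
have B1 : 0 < B + 1 by lra.
(* The first bound keeps a + d below [b]. Dividing by [B + 1] rather than [B] avoids a zero
   denominator and makes d * B strictly less than - p.[a]. *)
pose d := Num.min ((b - a) / 2) (- p.[a] / (B + 1)).
have d0 : 0 < d.
  by rewrite lt_min; apply/andP; split; [lra | rewrite divr_gt0 //; lra].
have d1 : d <= (b - a) / 2 by rewrite ge_min lexx.
have d2 : d * (B + 1) <= - p.[a] by rewrite -ler_pdivlMr // ge_min lexx orbT.
have xab : `|a + d| <= `|a| + `|b|.
  by rewrite ler_norml; have := ler_norm b; have := ler_norm (- b); have := ler_norm a;
     have := ler_norm (- a); rewrite !normrN; lra.
have hx : 0 <= p.[a + d] by apply: h; lra.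
have := congr1 (fun r : {poly R} => r.[a + d]) qE.
rewrite !hornerE => E; have qd := ler_norm q.[a + d]; have qB := hB _ xab.
have : q.[a + d] * d <= B * d by rewrite ler_pM2r //; apply: le_trans qB.
lra.
Qed.

Lemma prod_XsubC_gt0 s x : (forall l, l \in s -> l < x) ->
  0 < (\prod_(l <- s) ('X - l%:P)).[x].
Proof.
move=> h; rewrite horner_prod big_seq_cond prodr_gt0 // => l /andP[ls _].
by rewrite hornerXsubC subr_gt0 h.
Qed.

Lemma prod_XsubC_le0_root s x : (\prod_(l <- s) ('X - l%:P)).[x] <= 0 ->
  exists2 l, l \in s & x <= l.
Proof.
move=> h; have [/hasP[l ls xl]|/hasPn n] := boolP (has (fun l => x <= l) s); first by exists l.
by move: h; rewrite leNgt prod_XsubC_gt0 // => l /n; rewrite -ltNge.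
Qed.

(** Intermediate value theorem for split polynomials: a factor whose root is not strictly between
    [x] and [y] does not change sign from [x] to [y]. *)
Lemma prod_XsubC_sign_root s x y : x < y ->
  (\prod_(l <- s) ('X - l%:P)).[x] * (\prod_(l <- s) ('X - l%:P)).[y] < 0 ->
  exists l, [/\ l \in s, x < l & l < y].
Proof.
move=> xy h.
have [/hasP[l ls /andP[xl ly]]|/hasPn n] := boolP (has (fun l => (x < l) && (l < y)) s).
  by exists l.
move: h; rewrite ltNge => /negP[]; rewrite !horner_prod -big_split big_seq_cond.
apply: prodr_ge0 => l /andP[ls _] /=; rewrite !hornerXsubC.
have := n l ls; rewrite negb_and -!leNgt => /orP[lx|yl].
  by rewrite mulr_ge0 //; lra.
by rewrite mulr_le0 //; lra.
Qed.

(** At a double root the product is quadratically small, against the linear lower bound. The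
    polynomial [q] makes room for the denominator of a root quotient. *)
Lemma count_mem_le1 s x b c q : x < b -> 0 < c -> 0 < q.[x] ->
  (forall y, x < y -> y < b ->
     c * (y - x) * q.[y] <= `|(\prod_(l <- s) ('X - l%:P)).[y]|) ->
  (count_mem x s <= 1)%N.
Proof.
move=> xb c0 qx h; rewrite leqNgt; apply/negP => c2.
pose t := rem x (rem x s); have sE : perm_eq s [:: x, x & t].
  have xs : x \in s by rewrite -has_pred1 has_count ltnW.
  apply: perm_trans (perm_to_rem xs) _; rewrite perm_cons; apply: perm_to_rem.
  rewrite -has_pred1 has_count; have /permP/(_ (pred1 x)) := perm_to_rem xs.
  by move=> /= E; move: c2; rewrite E eqxx add1n ltnS.
pose g := \prod_(l <- t) ('X - l%:P).
have pE y : (\prod_(l <- s) ('X - l%:P)).[y] = (y - x) ^+ 2 * g.[y].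
  rewrite (perm_big _ sE) /= !big_cons !hornerM !hornerXsubC; ring.
have [B hB] := poly_disk_bound g (`|x| + `|b|).
have H y : x < y -> y < b -> c * q.[y] <= (y - x) * B.
  move=> xy yb; have := h y xy yb; have yx : 0 < y - x by rewrite subr_gt0.
  rewrite pE normrM (ger0_norm (exprn_ge0 _ (ltW yx))).
  have -> : c * (y - x) * q.[y] = (y - x) * (c * q.[y]) by ring.
  rewrite expr2 -mulrA ler_pM2l // => /le_trans; apply; rewrite ler_pM2l //.
  apply: hB; rewrite ler_norml; have := ler_norm b; have := ler_norm (- b);
    have := ler_norm x; have := ler_norm (- x); rewrite !normrN; lra.
have : 0 <= (B *: ('X - x%:P) - c *: q).[x].
  apply: (@poly_ge0_right _ _ b) => // y xy yb; rewrite !hornerE subr_ge0 mulrC.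
  by have := H y xy yb; lra.
rewrite !hornerE subrr mulr0 sub0r oppr_ge0 leNgt mulr_gt0 //.
Qed.

End RealPolynomials.

(** * The root quotient and the nu-value *)

Section RootQuotient.
Variables (V : finType) (e : rel V).
Hypothesis sg : simple_graph e.
Implicit Types (S T : {set V}) (r u v : V) (a b x y : algR).
Local Notation c S := (chi e algR S).
Local Notation T S r u := (tcomp e (S :\ r) u).

Definition roots_le S a := forall x, root (c S) x -> x <= a.

Lemma roots_leP S a : roots_le S a <-> forall x, a < x -> 0 < (c S).[x].
Proof.
have [s sE] := chi_split sg S; split=> [h x ax|h x rx].
  rewrite sE prod_XsubC_gt0 // => l ls; apply: le_lt_trans ax; apply: h.
  by rewrite sE root_prod_XsubC.
by rewrite leNgt; apply/negP => /h; rewrite (rootP rx) ltxx.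
Qed.

Lemma roots_le_ge0 S a : roots_le S a -> 0 <= (c S).[a].
Proof.
move/roots_leP=> h; apply: (@poly_ge0_right _ _ _ (a + 1)) => [|x ax _]; first by lra.
exact/ltW/h.
Qed.

Lemma roots_le_subset S S' a : S' \subset S -> roots_le S a -> roots_le S' a.
Proof. exact: roots_le_sub. Qed.

Lemma chi_le0_root S x : (c S).[x] <= 0 -> exists2 l, root (c S) l & x <= l.
Proof.
have [s sE] := chi_split sg S; rewrite sE => /prod_XsubC_le0_root[l ls xl].
by exists l; rewrite // root_prod_XsubC.
Qed.

Lemma chi_sign_root S x y : x < y -> (c S).[x] * (c S).[y] < 0 ->
  exists l, [/\ root (c S) l, x < l & l < y].
Proof.
have [s sE] := chi_split sg S; rewrite sE => xy /(prod_XsubC_sign_root xy)[l [ls ? ?]].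
by exists l; rewrite root_prod_XsubC.
Qed.

(** The function f of the overview. Since sqrt z + 1/sqrt z = 2 at z = 1, its inverse at 2 is the
    value of q_T at 1. *)
Definition rquot S r x := (c S).[x] / (c (S :\ r)).[x].

Lemma nbr_subset S r u : r \in S -> u \in S -> e r u ->
  T S r u \subset S :\ r /\ T S r u :\ u \subset S :\ r.
Proof.
move=> rS uS eru; have sub := tcomp_D1_sub sg rS uS eru; split=> //.
exact: subset_trans (subD1set _ _) sub.
Qed.

Lemma rquotE S r x : is_tree e S -> r \in S -> (c (S :\ r)).[x] != 0 ->
  rquot S r x = x - \sum_(u in S | e r u) (rquot (T S r u) u x)^-1.
Proof.
move=> tS rS nz; rewrite /rquot (chi_root_quotient sg tS rS nz) mulrAC mulfV // mul1r.
by congr (_ - _); apply: eq_bigr => u _; rewrite invf_div.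
Qed.

Lemma rquot_slope S r : is_tree e S -> r \in S ->
  forall a x y, roots_le (S :\ r) a -> a < y -> y <= x ->
  x - y <= rquot S r x - rquot S r y.
Proof.
move: S r; apply: rooted_tree_ind => // S r tS rS IH a x y ha ay yx.
have ax := lt_le_trans ay yx.
have nz z : a < z -> (c (S :\ r)).[z] != 0 by move/(proj1 (roots_leP _ _) ha)/gt_eqF/negbT.
rewrite !rquotE ?nz //.
suff : \sum_(u in S | e r u) (rquot (T S r u) u x)^-1 <=
       \sum_(u in S | e r u) (rquot (T S r u) u y)^-1 by lra.
apply: ler_sum => u /andP[uS eru]; have [s1 s2] := nbr_subset rS uS eru.
have h1 := roots_le_subset s1 ha; have h2 := roots_le_subset s2 ha.
(* Both branch polynomials are positive beyond [a], so inversion reverses the order of the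
   increasing branch quotient. *)
have p z : a < z -> 0 < rquot (T S r u) u z.
  move=> az; apply: divr_gt0; first exact: (proj1 (roots_leP _ _) h1).
  exact: (proj1 (roots_leP _ _) h2).
rewrite lef_pV2 ?posrE ?p //.
by have := IH u uS eru a x y h2 ay yx; lra.
Qed.

(** Extends [rquot_slope] to the endpoint y = a. The polynomial [P] is the slope defect multiplied
    by the two denominators, so its sign passes to [a] by [poly_ge0_right]. *)
Lemma rquot_slope_at S r a x y : is_tree e S -> r \in S ->
  roots_le (S :\ r) a -> 0 < (c (S :\ r)).[a] -> a <= y -> y <= x ->
  x - y <= rquot S r x - rquot S r y.
Proof.
move=> tS rS ha pa; rewrite le_eqVlt => /predU1P[<-|ay] yx; last exact: (rquot_slope tS rS ha).
have [->|xa] := eqVneq x a; first by lra.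
have {xa}ax : a < x by rewrite lt_neqAle eq_sym xa.
have hp := proj1 (roots_leP _ _) ha.
pose P := (c S).[x] *: c (S :\ r) - (c (S :\ r)).[x] *: c S
   - (c (S :\ r)).[x] *: ((x%:P - 'X) * c (S :\ r)).
have PE z : 0 < (c (S :\ r)).[z] ->
    P.[z] = (c (S :\ r)).[x] * (c (S :\ r)).[z] * (rquot S r x - rquot S r z - (x - z)).
  move=> pz; have px := hp x ax.
  rewrite /P !(hornerD, hornerN, hornerZ, hornerM, hornerC, hornerX) /rquot; field.
  by rewrite !gt_eqF.
have : 0 <= P.[a].
  apply: (poly_ge0_right ax) => z az zx; have pz := hp z az.
  rewrite PE //; apply: mulr_ge0; first by rewrite ltW // mulr_gt0 // hp.
  by rewrite subr_ge0; apply: (rquot_slope tS rS ha) => //; apply: ltW.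
by rewrite PE // pmulr_rge0 ?subr_ge0 // mulr_gt0 // hp.
Qed.

(* If a branch polynomial vanished at [a], the branch would contribute a pole
   driving [rquot] to -oo on the right of [a]. *)
Lemma chi_nbr_gt0 S r a b C : is_tree e S -> r \in S -> roots_le (S :\ r) a -> a < b ->
  (forall u, u \in S -> e r u -> 0 < (c (T S r u :\ u)).[a]) ->
  (forall x, a < x -> x < b -> - C <= rquot S r x) ->
  forall u, u \in S -> e r u -> 0 < (c (T S r u)).[a].
Proof.
move=> tS rS ha ab perron hC u uS eru; have [s1 s2] := nbr_subset rS uS eru.
have h1 := roots_le_subset s1 ha.
have hp := proj1 (roots_leP _ _) ha.
have := roots_le_ge0 h1; rewrite le_eqVlt => /predU1P[E|//].
have : 0 <= (('X + C%:P) * c (T S r u) - c (T S r u :\ u)).[a].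
  apply: (poly_ge0_right ab) => x ax xb; rewrite !hornerE.
  have px w : w \in S -> e r w -> 0 < (c (T S r w)).[x] /\ 0 < (c (T S r w :\ w)).[x].
    move=> wS erw; have [s3 s4] := nbr_subset rS wS erw.
    by split; apply: (proj1 (roots_leP _ a)) => //; apply: roots_le_subset ha.
  have := hC x ax xb; rewrite rquotE ?gt_eqF ?hp // (bigD1 u) ?uS //=.
  set t := \sum_(_ | _) _; have : 0 <= t.
    apply: sumr_ge0 => w /andP[/andP[wS erw] _].
    by have [p1 p2] := px w wS erw; rewrite invr_ge0 divr_ge0 ?ltW.
  have [p1 p2] := px u uS eru; move=> t0 hx.
  rewrite subr_ge0 -ler_pdivrMr //.
  by move: hx; rewrite /rquot invf_div; lra.
by rewrite !hornerE -E mulr0 sub0r oppr_ge0 leNgt perron.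
Qed.

Lemma chi_D1_prod S r x : is_tree e S -> r \in S ->
  (c (S :\ r)).[x] = \prod_(u in S | e r u) (c (T S r u)).[x].
Proof. by move=> tS rS; rewrite chi_D1 // horner_prod. Qed.

(** Perron-Frobenius for trees: even if [a] is the largest eigenvalue of [S], those of [S :\ r] stay
    strictly below it. Indeed [rquot] is nonnegative to the right of [a], so [chi_nbr_gt0] excludes
    a pole; its hypothesis on the branches is the induction hypothesis. *)
Lemma chi_D1_gt0 S r : is_tree e S -> r \in S ->
  forall a, roots_le S a -> 0 < (c (S :\ r)).[a].
Proof.
move: S r; apply: rooted_tree_ind => // S r tS rS IH a ha.
have ha' : roots_le (S :\ r) a by apply: roots_le_subset ha; apply: subD1set.
rewrite chi_D1_prod // prodr_gt0 // => u /andP[uS eru].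
apply: (@chi_nbr_gt0 S r a (a + 1) 0) => //; first by lra.
  move=> w wS erw; apply: IH => //; apply: roots_le_subset ha'.
  by have [] := nbr_subset rS wS erw.
move=> x ax _; rewrite oppr0 divr_ge0 // ltW //.
  exact: (proj1 (roots_leP _ _) ha).
exact: (proj1 (roots_leP _ _) ha').
Qed.

(** Here [S] itself may have eigenvalues beyond [a], so the lower bound on [rquot] must be supplied;
    the branches still satisfy [chi_D1_gt0]. *)
Lemma chi_D1_gt0_bounded S r a b C : is_tree e S -> r \in S -> roots_le (S :\ r) a -> a < b ->
  (forall x, a < x -> x < b -> - C <= rquot S r x) ->
  forall u, u \in S -> e r u -> 0 < (c (T S r u)).[a].
Proof.
move=> tS rS ha ab hC; apply: (chi_nbr_gt0 tS rS ha ab _ hC) => u uS eru.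
apply: chi_D1_gt0; [exact: tcomp_tree | exact: tcomp_id |].
by apply: roots_le_subset ha; case: (nbr_subset rS uS eru).
Qed.

Lemma roots_le_D1 S r a : is_tree e S -> r \in S ->
  (forall u, u \in S -> e r u -> roots_le (T S r u) a) -> roots_le (S :\ r) a.
Proof.
move=> tS rS h; apply/roots_leP => x ax; rewrite chi_D1_prod // prodr_gt0 // => u /andP[uS eru].
by apply: (proj1 (roots_leP _ _) (h u uS eru)).
Qed.

End RootQuotient.

(** * The nu-value as a value of the root quotient at 2 *)

Section NuValue.
Variables (V : finType) (e : rel V).
Hypothesis sg : simple_graph e.
Implicit Types (S T : {set V}) (r u v : V).
Local Notation c S := (chi e algR S).
Local Notation T S r u := (tcomp e (S :\ r) u).
Local Notation q S := (chi e rat S).[2].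
Local Notation rr := (ratr : rat -> algR).

Lemma Rpoly_at1 S : bipartite e S -> (Rpoly e S).[1] = q S.
Proof.
move=> bS; rewrite /Rpoly horner_sum (horner_coef_wide _ (_ : _ <= #|S|.+1)%N) ?size_chi //.
rewrite big_mkcond /=; apply: eq_bigr => j _; case: ifPn => [|/negPn oj].
  by rewrite hornerZ hornerM !horner_exp hornerD hornerX hornerC expr1n mulr1.
by rewrite (coef_chi_bipartite bS) ?mul0r // -ltnS.
Qed.

(** A common factor cannot vanish at 1 when the numerator does not, so the pole is visible without
    reducing the fraction. *)
Lemma ratfun_at1E (P Q : {poly rat}) : P.[1] != 0 ->
  ratfun_at1 P Q = if Q.[1] == 0 then +oo%E else ((P.[1] / Q.[1])%:E)%E.
Proof.
move=> P1; rewrite /ratfun_at1 /=; set g := gcdp P Q.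
have PE : P = P %/ g * g by rewrite divpK // dvdp_gcdl.
have QE : Q = Q %/ g * g by rewrite divpK // dvdp_gcdr.
have g1 : g.[1] != 0 by apply: contraNneq P1 => g0; rewrite PE hornerM g0 mulr0.
have -> : (Q.[1] == 0) = ((Q %/ g).[1] == 0).
  by rewrite {1}QE hornerM mulf_eq0 (negPf g1) orbF.
case: ifPn => // Q1; congr (_%:E)%E.
by rewrite [in RHS]PE [in RHS]QE !hornerM -mulf_div divff // mulr1.
Qed.

Lemma chi_at2 S : (c S).[2] = rr (q S).
Proof.
rewrite -(map_chi e (ratr : {rmorphism rat -> algR})).
by rewrite -(rmorph_nat (ratr : {rmorphism rat -> algR}) 2) horner_map.
Qed.

Lemma quot_num_at1 S r : is_tree e S -> r \in S -> (quot_num e S r).[1] = q (S :\ r).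
Proof.
move=> tS rS; rewrite /quot_num (chi_D1 sg) // !horner_prod; apply: eq_bigr => u /andP[uS eru].
by apply/Rpoly_at1/(tree_bipartite sg)/tcomp_tree.
Qed.

(** By [chi_D1_gt0] the numerator is nonzero at 1, so the value is infinite exactly when 2 is an
    eigenvalue. *)
Lemma nuE S r : is_tree e S -> r \in S -> roots_le e S 2 ->
  nu e S r = if q S == 0 then +oo%E else ((q (S :\ r) / q S)%:E)%E.
Proof.
move=> tS rS hS; have qp : 0 < q (S :\ r).
  by have := chi_D1_gt0 sg tS rS hS; rewrite chi_at2 ltr0q.
have qn1 := quot_num_at1 tS rS.
rewrite /nu ratfun_at1E ?qn1 ?Rpoly_at1 //; first exact: (tree_bipartite sg).
by rewrite gt_eqF.
Qed.

Lemma nu_forest_cases S r : is_tree e S -> r \in S -> roots_le e (S :\ r) 2 ->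
  (exists k : rat, [/\ forall u, u \in S -> e r u -> 0 < (c (T S r u)).[2],
     nu_forest e S r = (k%:E)%E & rquot e S r 2 = 2 - rr k]) \/
  (nu_forest e S r = +oo%E /\ exists u, [/\ u \in S, e r u & (c (T S r u)).[2] = 0]).
Proof.
move=> tS rS ha.
have hT u : u \in S -> e r u -> [/\ is_tree e (T S r u), u \in T S r u & roots_le e (T S r u) 2].
  move=> uS eru; split; [exact: tcomp_tree | exact: tcomp_id |].
  by apply: roots_le_subset ha => //; case: (nbr_subset sg rS uS eru).
have [/existsP[u /and3P[uS eru /eqP q0]]|n0] :=
  boolP [exists u, [&& u \in S, e r u & q (T S r u) == 0]].
  right; split; last by exists u; rewrite chi_at2 q0 rmorph0.
  (* One infinite summand decides the sum because no summand is -oo. *)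
  apply/eqP; rewrite /nu_forest esum_eqy; last first.
    move=> w /andP[wS erw]; have [tT wT rT] := hT w wS erw.
    by rewrite nuE //; case: ifP.
  apply/exists_inP; exists u; first by apply/andP.
  by have [tT uT rT] := hT u uS eru; rewrite nuE // q0 eqxx.
left; exists (\sum_(u in S | e r u) q (T S r u :\ u) / q (T S r u)).
have qn0 u : u \in S -> e r u -> q (T S r u) != 0.
  by move=> uS eru; apply: contraNneq n0 => q0; apply/existsP; exists u; rewrite uS eru q0 eqxx.
have pos u : u \in S -> e r u -> 0 < (c (T S r u)).[2].
  move=> uS eru; have [tT uT rT] := hT u uS eru.
  by rewrite lt_neqAle (roots_le_ge0 sg rT) andbT eq_sym chi_at2 fmorph_eq0 qn0.
split=> //.
  rewrite /nu_forest -sumEFin; apply: eq_bigr => u /andP[uS eru].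
  by have [tT uT rT] := hT u uS eru; rewrite nuE // (negPf (qn0 _ _ _)).
rewrite rquotE //; last first.
  rewrite chi_D1_prod //; apply/prodf_neq0 => u /andP[uS eru]; by rewrite gt_eqF ?pos.
congr (_ - _); rewrite rmorph_sum; apply: eq_bigr => u _.
by rewrite /rquot invf_div !chi_at2 fmorph_div.
Qed.

(** An infinite value means that some branch has eigenvalue 2, which would drive [rquot] to -oo on
    the right of 2. *)
Lemma nu_forest_bounded S r b C : is_tree e S -> r \in S -> roots_le e (S :\ r) 2 -> 2 < b ->
  (forall x, 2 < x -> x < b -> - C <= rquot e S r x) ->
  exists k : rat, [/\ 0 < (c (S :\ r)).[2],
     nu_forest e S r = (k%:E)%E & rquot e S r 2 = 2 - rr k].
Proof.
move=> tS rS ha ab hC; have pos := chi_D1_gt0_bounded sg tS rS ha ab hC.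
have [[k [_ E1 E2]]|[_ [u [uS eru]]]] := nu_forest_cases tS rS ha; last first.
  by move/eqP; rewrite gt_eqF // pos.
exists k; split=> //; rewrite chi_D1_prod // prodr_gt0 // => u /andP[uS eru]; exact: pos.
Qed.

(** Here f(2) = 2 - nu(T') is nonnegative, and slope at least 1 makes f positive beyond 2. *)
Lemma nu_forest_le2 S r : is_tree e S -> r \in S -> roots_le e (S :\ r) 2 ->
  (nu_forest e S r <= 2%:E)%E -> roots_le e S 2.
Proof.
move=> tS rS ha; have [[k [pos -> E2]]|[-> _]] := nu_forest_cases tS rS ha; last by [].
rewrite lee_fin => k2; apply/(roots_leP sg) => x x2.
have p2 : 0 < (c (S :\ r)).[2].
  by rewrite chi_D1_prod // prodr_gt0 // => u /andP[uS eru]; exact: pos.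
have px := proj1 (roots_leP sg _ _) ha x x2.
have := rquot_slope_at sg tS rS ha p2 (lexx _) (ltW x2); rewrite E2 => h.
have : rr k <= 2 by rewrite -(rmorph_nat (ratr : {rmorphism rat -> algR}) 2) ler_rat.
move=> k2'; have : 0 < rquot e S r x by lra.
by rewrite /rquot pmulr_lgt0 // invr_gt0.
Qed.

Lemma roots_le_nu_forest S r : is_tree e S -> r \in S -> roots_le e S 2 ->
  (nu_forest e S r <= 2%:E)%E.
Proof.
move=> tS rS hS; have ha : roots_le e (S :\ r) 2.
  by apply: roots_le_subset hS => //; apply: subD1set.
(* Beyond 2 both polynomials are positive, so 0 is a lower bound for [rquot]; 3 is an arbitrary
   right end. *)
have [||k [p2 -> E2]] := @nu_forest_bounded S r 3 0 tS rS ha; first by lra.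
  move=> x x2 _; rewrite oppr0 divr_ge0 // ltW //.
    exact: (proj1 (roots_leP sg _ _) hS).
  exact: (proj1 (roots_leP sg _ _) ha).
rewrite lee_fin; have : 0 <= rquot e S r 2.
  by rewrite divr_ge0 ?(roots_le_ge0 sg hS) ?(roots_le_ge0 sg ha).
rewrite E2 subr_ge0 -(rmorph_nat (ratr : {rmorphism rat -> algR}) 2) ler_rat //.
Qed.

End NuValue.

(** * Joins of two trees *)

Section ExpandingPair.
Variables (R : realFieldType) (a : R).
Implicit Types (f g : R -> R) (x y l m : R).

Definition expanding f := forall x y, a < y -> y <= x -> x - y <= f x - f y.

Lemma expanding_gt0 f l x : expanding f -> a < l -> f l = 0 -> l < x -> 0 < f x.
Proof. by move=> ef al fl lx; have := ef x l al (ltW lx); lra. Qed.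

Lemma expanding_lt0 f l x : expanding f -> f l = 0 -> a < x -> x < l -> f x < 0.
Proof. by move=> ef fl ax xl; have := ef l x ax (ltW xl); lra. Qed.

(** The explicit gain, linear in x - y, yields uniqueness of a root and also the lower bound that
    [count_mem_le1] needs for its simplicity. *)
Lemma expanding_mul_upper f g y x : expanding f -> expanding g ->
  a < y -> y <= x -> 0 < f y -> 0 < g y -> f y * g y + (x - y) * g y <= f x * g x.
Proof.
move=> ef eg ay yx f0 g0; have hf := ef x y ay yx; have hg := eg x y ay yx.
rewrite -mulrDl; apply: ler_pM; lra.
Qed.

(** Where both functions are negative their absolute values decrease, so the product loses a linear
    amount. *)
Lemma expanding_mul_lower f g y x : expanding f -> expanding g ->
  a < y -> y <= x -> f x < 0 -> g x < 0 -> f x * g x <= f y * g y - (x - y) * - g y.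
Proof.
move=> ef eg ay yx f0 g0; have hf := ef x y ay yx; have hg := eg x y ay yx.
have -> : f y * g y - (x - y) * - g y = (- f y - (x - y)) * - g y by ring.
by rewrite -mulrNN; apply: ler_pM; lra.
Qed.

End ExpandingPair.

(** * Eigenvalues above 2 of a join *)

Section Join.
Variables (V : finType) (e : rel V).
Hypothesis sg : simple_graph e.
Variables (S1 S2 S : {set V}) (r1 r2 : V).
Local Notation c S := (chi e algR S).
Hypotheses (J : is_join e S1 r1 S2 r2 S) (t1 : is_tree e S1) (t2 : is_tree e S2).
Hypotheses (a1 : roots_le e (S1 :\ r1) 2) (a2 : roots_le e (S2 :\ r2) 2).
Variables (l1 l2 : algR).
Hypotheses (l1r : root (c S1) l1) (l2r : root (c S2) l2) (l1_2 : 2 < l1) (l2_2 : 2 < l2).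

Let R1 : r1 \in S1. Proof. by case: J. Qed.
Let R2 : r2 \in S2. Proof. by case: J. Qed.
Local Notation f1 := (rquot e S1 r1).
Local Notation f2 := (rquot e S2 r2).
Local Notation p1 := (c (S1 :\ r1)).
Local Notation p2 := (c (S2 :\ r2)).

Let p1_gt0 x : 2 < x -> 0 < p1.[x]. Proof. exact: (proj1 (roots_leP sg _ _) a1). Qed.
Let p2_gt0 x : 2 < x -> 0 < p2.[x]. Proof. exact: (proj1 (roots_leP sg _ _) a2). Qed.

Let ex1 : expanding 2 f1. Proof. by move=> x y; apply: rquot_slope. Qed.
Let ex2 : expanding 2 f2. Proof. by move=> x y; apply: rquot_slope. Qed.
Let f1l : f1 l1 = 0. Proof. by rewrite /rquot (rootP l1r) mul0r. Qed.
Let f2l : f2 l2 = 0. Proof. by rewrite /rquot (rootP l2r) mul0r. Qed.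

Lemma chi_join_rquot x : 0 < p1.[x] -> 0 < p2.[x] ->
  (c S).[x] = p1.[x] * p2.[x] * (f1 x * f2 x - 1).
Proof.
move=> h1 h2; rewrite (chi_join algR sg J) !(hornerD, hornerN, hornerM) /rquot; field.
by rewrite !gt_eqF.
Qed.

Let chiE x : 2 < x -> (c S).[x] = p1.[x] * p2.[x] * (f1 x * f2 x - 1).
Proof. by move=> x2; rewrite chi_join_rquot ?p1_gt0 ?p2_gt0. Qed.

Let pp_gt0 x : 2 < x -> 0 < p1.[x] * p2.[x].
Proof. by move=> x2; rewrite mulr_gt0 ?p1_gt0 ?p2_gt0. Qed.

Let rootE x : 2 < x -> root (c S) x = (f1 x * f2 x == 1).
Proof. by move=> x2; rewrite /root chiE // mulf_eq0 gt_eqF ?pp_gt0 // subr_eq0. Qed.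

(** At the larger of [l1] and [l2] the product f1 f2 is 0, so [chi] is negative there and, being
    monic and split, has a root further right. *)
Lemma join_upper_root : exists x, [/\ root (c S) x, l1 < x & l2 < x].
Proof.
have key M : 2 < M -> f1 M * f2 M = 0 -> l1 <= M -> l2 <= M ->
    exists x, [/\ root (c S) x, l1 < x & l2 < x].
  move=> M2 fM h1 h2; have cM : (c S).[M] < 0.
    by rewrite chiE // fM sub0r mulrN1 oppr_lt0 pp_gt0.
  have [x rx Mx] := chi_le0_root sg (ltW cM).
  have {}Mx : M < x.
    rewrite lt_neqAle Mx andbT; apply: contraTneq rx => <-.
    by rewrite /root lt_eqF.
  by exists x; split=> //; [apply: le_lt_trans Mx | apply: le_lt_trans Mx].
case: (leP l1 l2) => h; [apply: (key l2) | apply: (key l1)] => //.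
- by rewrite f2l mulr0.
- by rewrite f1l mul0r.
exact: ltW.
Qed.

Lemma join_root_cases x : 2 < x -> root (c S) x ->
  (l1 < x /\ l2 < x) \/ (x < l1 /\ x < l2).
Proof.
move=> x2; rewrite rootE // => /eqP fx.
have n1 : l1 != x by apply: contra_eq_neq fx => <-; rewrite f1l mul0r eq_sym oner_neq0.
have n2 : l2 != x by apply: contra_eq_neq fx => <-; rewrite f2l mulr0 eq_sym oner_neq0.
have [h1|h1|/eqP] := ltgtP l1 x; last by rewrite (negPf n1).
  have [h2|h2|/eqP] := ltgtP l2 x; [by left| |by rewrite (negPf n2)].
  have g1 := expanding_gt0 ex1 l1_2 f1l h1; have g2 := expanding_lt0 ex2 f2l x2 h2.
  by have := nmulr_llt0 (f1 x) g2; rewrite g1 fx ltr10.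
have [h2|h2|/eqP] := ltgtP l2 x; [|by right|by rewrite (negPf n2)].
have g1 := expanding_lt0 ex1 f1l x2 h1; have g2 := expanding_gt0 ex2 l2_2 f2l h2.
by have := pmulr_llt0 (f1 x) g2; rewrite g1 fx ltr10.
Qed.

Lemma join_upper_unique x y : root (c S) x -> root (c S) y ->
  l1 < x -> l2 < x -> l1 < y -> l2 < y -> x = y.
Proof.
have main u v : u < v -> root (c S) u -> root (c S) v -> l1 < u -> l2 < u -> False.
  move=> uv ru rv h1 h2; have u2 := lt_trans l1_2 h1; have v2 := lt_trans u2 uv.
  have g1 := expanding_gt0 ex1 l1_2 f1l h1; have g2 := expanding_gt0 ex2 l2_2 f2l h2.
  have := expanding_mul_upper ex1 ex2 u2 (ltW uv) g1 g2.
  move: ru rv; rewrite !rootE // => /eqP-> /eqP->.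
  have : 0 < (v - u) * f2 u by rewrite mulr_gt0 // subr_gt0.
  lra.
move=> rx ry x1 x2 y1 y2; case: (ltgtP x y) => // h.
  by case: (main x y).
by case: (main y x).
Qed.

Lemma join_lower_unique x y : root (c S) x -> root (c S) y -> 2 < x -> 2 < y ->
  x < l1 -> x < l2 -> y < l1 -> y < l2 -> x = y.
Proof.
have main u v : u < v -> 2 < u -> root (c S) u -> root (c S) v -> v < l1 -> v < l2 -> False.
  move=> uv u2 ru rv h1 h2; have v2 := lt_trans u2 uv.
  have g1 := expanding_lt0 ex1 f1l v2 h1; have g2 := expanding_lt0 ex2 f2l v2 h2.
  have := expanding_mul_lower ex1 ex2 u2 (ltW uv) g1 g2.
  move: ru rv; rewrite !rootE // => /eqP-> /eqP->.
  have g2u := expanding_lt0 ex2 f2l u2 (lt_trans uv h2).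
  have : 0 < (v - u) * - f2 u by rewrite mulr_gt0 ?subr_gt0 ?oppr_gt0.
  lra.
move=> rx ry x0 y0 x1 x2 y1 y2; case: (ltgtP x y) => // h.
  by case: (main x y).
by case: (main y x).
Qed.

Local Notation nu1 := (nu_forest e S1 r1).
Local Notation nu2 := (nu_forest e S2 r2).
Hypotheses (n1 : (2%:E < nu1)%E) (n2 : (2%:E < nu2)%E).

Lemma join_no_lower_root x : ((nu1 - 2%:E) * (nu2 - 2%:E) <= 1%:E)%E ->
  root (c S) x -> 2 < x -> x < l1 -> x < l2 -> False.
Proof.
move=> le1 rx x2 x1 x2'.
have pinf (z : \bar rat) : (2%:E < z)%E -> (0 < z - 2%:E)%E.
  by case: z => [z| |] //; rewrite lte_fin -EFinB lte_fin subr_gt0.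
have [[k1 [pos1 E1 F1]]|[E1 _]] := nu_forest_cases sg t1 R1 a1; last first.
  by move: le1; rewrite E1 gt0_mulye // pinf.
have [[k2 [pos2 E2 F2]]|[E2 _]] := nu_forest_cases sg t2 R2 a2; last first.
  by move: le1; rewrite E2 gt0_muley // pinf.
move: le1; rewrite E1 E2 -!EFinB -EFinM lee_fin -(ler_rat algR).
rewrite rmorphM !rmorphB rmorph1 !rmorph_nat => le1.
have q1 : 0 < p1.[2] by rewrite chi_D1_prod // prodr_gt0 // => u /andP[uS eru]; exact: pos1.
have q2 : 0 < p2.[2] by rewrite chi_D1_prod // prodr_gt0 // => u /andP[uS eru]; exact: pos2.
have s1 := rquot_slope_at sg t1 R1 a1 q1 (lexx _) (ltW x2).
have s2 := rquot_slope_at sg t2 R2 a2 q2 (lexx _) (ltW x2).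
have g1 := expanding_lt0 ex1 f1l x2 x1; have g2 := expanding_lt0 ex2 f2l x2 x2'.
(* By the slope bound from the endpoint 2, each factor is positive and at most k - 2 - (x - 2),
   hence less than k - 2; at a root the product is 1. *)
have : - f1 x * - f2 x < (ratr k1 - 2) * (ratr k2 - 2) by apply: ltr_pM; lra.
by rewrite mulrNN; move: rx; rewrite rootE // => /eqP->; rewrite ltNge le1.
Qed.

(** Without a root in (2, m), [chi] stays nonpositive there, so f1 f2 is at most 1. This bounds both
    quotients near 2, makes both nu-values finite, and in the limit gives f1(2) f2(2) at most 1,
    against the hypothesis. *)
Lemma join_lower_root : (1%:E < (nu1 - 2%:E) * (nu2 - 2%:E))%E ->
  exists x, [/\ root (c S) x, 2 < x, x < l1 & x < l2].
Proof.
move=> gt1; pose m := Num.min l1 l2.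
have m2 : 2 < m by rewrite lt_min l1_2.
have ml1 : m <= l1 by rewrite ge_min lexx.
have ml2 : m <= l2 by rewrite ge_min lexx orbT.
have cm : (c S).[m] < 0.
  rewrite chiE // (_ : f1 m * f2 m = 0) ?sub0r ?mulrN1 ?oppr_lt0 ?pp_gt0 //.
  by rewrite /m; case: (leP l1 l2) => _; rewrite ?f1l ?f2l ?mul0r ?mulr0.
have [s sE] := chi_split sg S.
have [/hasP[x xs /andP[x2 xm]]|/hasPn no] := boolP (has (fun x => (2 < x) && (x < m)) s).
  exists x; split=> //; first by rewrite sE root_prod_XsubC.
    exact: lt_le_trans ml1.
  exact: lt_le_trans ml2.
have le0 x : 2 < x -> x < m -> (c S).[x] <= 0.
  move=> x2 xm; rewrite leNgt; apply/negP => x0.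
  have [|l [rl xl lm]] := @chi_sign_root _ _ sg S _ _ xm; first by rewrite pmulr_rlt0.
  have ls : l \in s by rewrite -root_prod_XsubC -sE.
  by have := no l ls; rewrite lm (lt_trans x2 xl).
have le1 x : 2 < x -> x < m -> - f1 x * - f2 x <= 1.
  by move=> x2 xm; have := le0 x x2 xm; rewrite mulrNN chiE // pmulr_rle0 ?pp_gt0 // subr_le0.
(* On (2, y) each quotient has absolute value at least its positive value at [y], so the bound on
   the product bounds the other quotient. *)
pose y := (2 + m) / 2; have y2 : 2 < y by rewrite /y; lra.
have ym : y < m by rewrite /y; lra.
have [k1 [q1 E1 F1]] : exists k : rat,
    [/\ 0 < p1.[2], nu1 = (k%:E)%E & f1 2 = 2 - ratr k].
  have gy := expanding_lt0 ex2 f2l y2 (lt_le_trans ym ml2).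
  apply: (@nu_forest_bounded _ _ sg _ _ y (- f2 y)^-1) => // x x2 xy.
  have := le1 x x2 (lt_trans xy ym); have := ex2 x2 (ltW xy).
  have := expanding_lt0 ex1 f1l x2 (lt_le_trans (lt_trans xy ym) ml1) => g1 g2 h.
  rewrite lerNl -[X in _ <= X]mul1r ler_pdivlMr ?oppr_gt0 //; apply: le_trans h.
  by rewrite ler_pM2l ?oppr_gt0 //; lra.
have [k2 [q2 E2 F2]] : exists k : rat,
    [/\ 0 < p2.[2], nu2 = (k%:E)%E & f2 2 = 2 - ratr k].
  have gy := expanding_lt0 ex1 f1l y2 (lt_le_trans ym ml1).
  apply: (@nu_forest_bounded _ _ sg _ _ y (- f1 y)^-1) => // x x2 xy.
  have := le1 x x2 (lt_trans xy ym); have := ex1 x2 (ltW xy).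
  have := expanding_lt0 ex2 f2l x2 (lt_le_trans (lt_trans xy ym) ml2) => g1 g2 h.
  rewrite lerNl -[X in _ <= X]mul1r ler_pdivlMr ?oppr_gt0 //; apply: le_trans h.
  by rewrite mulrC ler_pM2r ?oppr_gt0 //; lra.
have : 0 <= (- c S).[2].
  by apply: (poly_ge0_right m2) => x x2 xm; rewrite hornerN oppr_ge0 le0.
rewrite hornerN oppr_ge0 chi_join_rquot // pmulr_rle0 ?mulr_gt0 // F1 F2 => le.
move: gt1; rewrite E1 E2 -!EFinB -EFinM lte_fin -(ltr_rat algR).
rewrite rmorphM !rmorphB rmorph1 !rmorph_nat ltNge => /negP[].
by move: le; lra.
Qed.

(** The list [s] carries multiplicities, so the upper and the lower root must both be shown
    simple. *)
Lemma join_count_roots s : (1%:E < (nu1 - 2%:E) * (nu2 - 2%:E))%E ->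
  c S = \prod_(l <- s) ('X - l%:P) -> count (fun l => 2 < l)%R s = 2%N.
Proof.
move=> gt1 sE; have rs l : root (c S) l = (l \in s) by rewrite sE root_prod_XsubC.
have [x [rx x1 x2]] := join_upper_root.
have [y [ry y0 y1 y2]] := join_lower_root gt1.
have x0 := lt_trans l1_2 x1.
have yx : y < x by apply: lt_trans y1 x1.
have cx : count_mem x s = 1%N.
  apply/eqP; rewrite eqn_leq andbC -has_count has_pred1 -rs rx /=.
  have g1 := expanding_gt0 ex1 l1_2 f1l x1; have g2 := expanding_gt0 ex2 l2_2 f2l x2.
  (* Beyond [x], where f1 f2 = 1, the product exceeds 1 by at least (z - x) * f2 x, and [p1 * p2] is
     the common positive factor of [chi]. *)
  apply: (@count_mem_le1 _ s x (x + 1) (f2 x) (p1 * p2)) => //; first by lra.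
    by rewrite hornerM pp_gt0.
  move=> z xz _; have z0 := lt_trans x0 xz; rewrite -sE chiE // hornerM.
  have := expanding_mul_upper ex1 ex2 x0 (ltW xz) g1 g2.
  move: rx; rewrite rootE // => /eqP-> h; apply: le_trans (ler_norm _).
  by rewrite mulrC ler_pM2l ?pp_gt0 //; lra.
have cy : count_mem y s = 1%N.
  apply/eqP; rewrite eqn_leq andbC -has_count has_pred1 -rs ry /=.
  have g2 := expanding_lt0 ex2 f2l y0 y2.
  apply: (@count_mem_le1 _ s y (Num.min l1 l2) (- f2 y) (p1 * p2)).
  - by rewrite lt_min y1.
  - by rewrite oppr_gt0.
  - by rewrite hornerM pp_gt0.
  move=> z yz; rewrite lt_min => /andP[z1 z2]; have z0 := lt_trans y0 yz.
  have := expanding_mul_lower ex1 ex2 y0 (ltW yz)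
    (expanding_lt0 ex1 f1l z0 z1) (expanding_lt0 ex2 f2l z0 z2).
  move: ry; rewrite rootE // => /eqP-> h; rewrite -sE chiE // hornerM.
  rewrite -normrN; apply: le_trans (ler_norm _).
  by rewrite -[X in _ <= X]mulrN mulrC ler_pM2l ?pp_gt0 //; lra.
have -> : count (fun l => 2 < l) s = count (predU (pred1 x) (pred1 y)) s.
  apply: eq_in_count => l; rewrite -rs => rl /=.
  apply/idP/orP => [l2'|[]/eqP-> //].
  have [[h1 h2]|[h1 h2]] := join_root_cases l2' rl.
    by left; apply/eqP; apply: join_upper_unique.
  by right; apply/eqP; apply: join_lower_unique.
have := count_predUI (pred1 x) (pred1 y) s; rewrite cx cy.
rewrite [X in (_ + X)%N](_ : _ = 0%N) ?addn0 //.
by rewrite -[RHS](count_pred0 s); apply: eq_count => l /=; case: eqP => // ->; rewrite gt_eqF.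
Qed.

End Join.

(** * Roots of the reciprocal polynomial *)

(** Allows polynomial identities to be checked through x + 1/x, which is meaningful only away from
    0. *)
Lemma poly_eq_nonzero (F : numFieldType) (p q : {poly F}) :
  (forall x, x != 0 -> p.[x] = q.[x]) -> p = q.
Proof.
move=> h; apply/eqP; rewrite -subr_eq0; apply/eqP.
apply: (@roots_geq_poly_eq0 _ _ [seq i.+1%:R | i <- iota 0 (size (p - q))]).
- apply/allP => _ /mapP[i _ ->]; rewrite /root !hornerE h ?subrr //.
  by rewrite pnatr_eq0.
- rewrite map_inj_uniq ?iota_uniq // => i j /eqP.
  by rewrite eqr_nat eqSS => /eqP.
- by rewrite size_map size_iota.
Qed.

(* The two solutions of z + 1/z = l. *)
Definition reciprocal_pair (l : algR) : algC * algC :=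
  let w := sqrtC (algRval l ^+ 2 - 4) in ((algRval l + w) / 2, (algRval l - w) / 2).

(** The product of the pair is 1. If |l| > 2, the absolute values sum to more than 2, so exactly one
    exceeds 1. Otherwise [w] squares to a nonpositive real, the two numbers are conjugate, and both
    lie on the unit circle. *)
Lemma reciprocal_pairP (l : algR) (z := reciprocal_pair l) :
  [/\ z.1 + z.2 = algRval l, z.1 * z.2 = 1 &
     ((1 < `|z.1|)%R + (1 < `|z.2|)%R)%N = (2 < `|l|)%R].
Proof.
rewrite /z /reciprocal_pair /=; set a := algRval l; set w := sqrtC _.
have w2 : w ^+ 2 = a ^+ 2 - 4 by rewrite sqrtCK.
set z1 := (a + w) / 2; set z2 := (a - w) / 2.
have zz : z1 * z2 = 1.
  have -> : z1 * z2 = (a ^+ 2 - w ^+ 2) / 4 by rewrite /z1 /z2; field.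
  by rewrite w2; field.
have zs : z1 + z2 = a by rewrite /z1 /z2; field.
split=> //.
have nz : `|z1| * `|z2| = 1 by rewrite -normrM zz normr1.
have ra : a \is Num.real by apply: algRvalP.
have [l2|l2] := ltP 2 `|l|.
  have : 2 < `|z1| + `|z2|.
    apply: lt_le_trans (ler_normD _ _); rewrite zs.
    have : algRval 2 < algRval `|l| by [].
    by rewrite (rmorph_nat (@algRval : {rmorphism algR -> algC})).
  case: (real_ltP (real1 _) (normr_real z1)) => h1;
    case: (real_ltP (real1 _) (normr_real z2)) => h2 //.
    have : 1 < `|z1| * `|z2| by rewrite -[1]mulr1 ltr_pM.
    by rewrite nz ltxx.
  have : `|z1| + `|z2| <= 1 + 1 by rewrite lerD.
  by move=> /le_lt_trans h /h; rewrite ltxx.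
have w2_le : w ^+ 2 <= 0.
  rewrite w2 subr_le0; have : algRval (l ^+ 2) <= algRval 4.
    change (l ^+ 2 <= 4); move: l2; rewrite ler_norml => /andP[? ?]; nra.
  rewrite (rmorphXn (@algRval : {rmorphism algR -> algC})).
  by rewrite (rmorph_nat (@algRval : {rmorphism algR -> algC})).
have wN : w^* = - w.
  have : (w^*) ^+ 2 == w ^+ 2.
    by rewrite -rmorphXn /= conj_Creal // w2 rpredB ?rpredX ?realn.
  rewrite eqf_sqr => /orP[/eqP/CrealP rw|/eqP //].
  have : w ^+ 2 = 0 by apply/eqP; rewrite eq_le w2_le real_exprn_even_ge0.
  by move/eqP; rewrite sqrf_eq0 => /eqP->; rewrite rmorph0 oppr0.
have n1 : `|z1| ^+ 2 = 1.
  rewrite normCK (_ : z1^* = z2) // /z1 rmorphM rmorphD /= wN (conj_Creal ra).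
  by rewrite fmorphV rmorph_nat.
have /eqP := n1; rewrite sqrp_eq1 // => /eqP h1.
by move: nz; rewrite h1 mul1r => ->; rewrite ltxx.
Qed.

Lemma prodr_const_seq (R : pzSemiRingType) (T : Type) (s : seq T) (x : R) :
  \prod_(i <- s) x = x ^+ size s.
Proof. by rewrite big_const_seq count_predT iter_mulr_1. Qed.

Lemma count_flatten_pair (T U : eqType) (P : pred U) (Q : pred T)
    (f g : T -> U) (m : nat) (s : seq T) :
  {in s, forall x, (P (f x) + P (g x) = Q x * m)%N} ->
  (count P (flatten [seq [:: f x; g x] | x <- s]) = count Q s * m)%N.
Proof.
elim: s => //= x s IH h; rewrite addnA h ?mem_head // IH ?mulnDl //.
by move=> y ys; apply: h; rewrite inE ys orbT.
Qed.

Lemma prod_flatten_pair (F : fieldType) (T : Type) (f g : T -> F) (s : seq T) :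
  \prod_(z <- flatten [seq [:: f x; g x] | x <- s]) ('X - z%:P) =
  \prod_(x <- s) (('X - (f x)%:P) * ('X - (g x)%:P)).
Proof.
elim: s => [|x s IH]; first by rewrite !big_nil.
by rewrite /= !big_cons IH mulrA.
Qed.

Section OutsideRoots.
Variables (V : finType) (e : rel V).
Hypothesis sg : simple_graph e.
Variables (S : {set V}) (s : seq algR).
Hypotheses (bS : bipartite e S) (sE : chi e algR S = \prod_(l <- s) ('X - l%:P)).

Lemma size_spectrum : size s = #|S|.
Proof. by have := size_chi e algR S; rewrite sE size_prod_XsubC => -[]. Qed.

Lemma spectrum_sym : perm_eq s (map -%R s).
Proof.
apply: prod_XsubC_eq; have := chi_compN algR bS; rewrite sE => E.
have -> : \prod_(l <- s) ('X - l%:P) = (-1) ^+ size s *: ((\prod_(l <- s) ('X - l%:P)) \Po - 'X).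
  by rewrite E size_spectrum scalerA -expr2 sqrr_sign scale1r.
rewrite big_map -[_ \Po _]/((comp_poly (- 'X)) _) rmorph_prod /=.
rewrite -mul_polyC polyC_exp polyCN polyC1 -prodr_const_seq -big_split /=.
by apply: eq_bigr => l _; rewrite rmorphB /= comp_polyX comp_polyC polyCN; ring.
Qed.

Lemma count_norm_gt2 : count (fun l => 2 < `|l|) s = (count (fun l => 2 < l)%R s).*2.
Proof.
have E : count (fun l => 2 < l) s = count (fun l => 2 < - l) s.
  by rewrite (permP spectrum_sym (fun l => 2 < l)) count_map.
rewrite -addnn [in X in (_ + X)%N]E.
rewrite -count_predUI -[LHS]addn0; congr (_ + _)%N.
  by apply: eq_count => l /=; rewrite lter_normr.
rewrite -[LHS](count_pred0 s); apply: eq_count => l /=.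
by case: (ltP 2 l) => //= ?; case: (ltP 2 (- l)) => //= ?; exfalso; clear E; lra.
Qed.

(** Putting z = x^2 removes the square roots: R(x^2) = x^n chi(x + 1/x), and each factor x + 1/x - l
    absorbs one power of x. *)
Lemma Rpoly_comp_X2 : (map_poly ratr (Rpoly e S)) \Po 'X^2 =
  \prod_(l <- s) ('X^2 - (algRval l) *: 'X + 1) :> {poly algC}.
Proof.
apply: poly_eq_nonzero => x x0.
have chiE : chi e algC S = \prod_(l <- s) ('X - (algRval l)%:P).
  rewrite -(map_chi e (@algRval : {rmorphism algR -> algC})) sE rmorph_prod.
  by apply: eq_bigr => l _; rewrite rmorphB /= map_polyX map_polyC.
have -> : (\prod_(l <- s) ('X^2 - algRval l *: 'X + 1)).[x] =
    x ^+ #|S| * (chi e algC S).[(x ^+ 2 + 1) / x].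
  rewrite chiE !horner_prod -size_spectrum -prodr_const_seq -big_split /=.
  by apply: eq_bigr => l _; rewrite !hornerE; field.
rewrite horner_comp hornerXn [in RHS](horner_coef_wide _ (_ : _ <= #|S|.+1)%N) ?size_chi //.
rewrite /Rpoly rmorph_sum horner_sum mulr_sumr big_mkcond /=.  apply: eq_bigr => j _.
have jS : (j <= #|S|)%N by rewrite -ltnS.
have cE : (chi e algC S)`_j = ratr (charpoly e S)`_j.
  by rewrite -(map_chi e (ratr : {rmorphism rat -> algC})) coef_map.
case: ifPn => [ev|/negPn od]; last first.
  by rewrite cE -/(chi e rat S) (coef_chi_bipartite bS) // rmorph0 mul0r mulr0.
rewrite map_polyZ /= hornerZ rmorphM /= !rmorphXn /= rmorphD /= map_polyX rmorph1.
rewrite !hornerE /= cE -exprM mul2n halfK (negPf ev) subn0.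
have xS : x ^+ #|S| = x ^+ j * x ^+ (#|S| - j) by rewrite -exprD subnKC.
rewrite expr_div_n xS; field.
by rewrite expf_neq0.
Qed.

(** The roots of R(x^2) are listed in two ways: as square roots of the roots of R, which count each
    outside root twice, and as reciprocal pairs, which count each eigenvalue with |l| > 2 once.
    Symmetry of the spectrum supplies the matching factor 2. *)
Lemma nroots_outside_Rpoly : nroots_outside (Rpoly e S) (count (fun l => 2 < l)%R s).
Proof.
set P := map_poly ratr (Rpoly e S) : {poly algC}.
have [rs rsE] := closed_field_poly_normal P; exists rs; split=> //.
set k := lead_coef P in rsE *.
pose A := flatten [seq [:: sqrtC z; - sqrtC z] | z <- rs].
pose B := flatten [seq [:: (reciprocal_pair l).1; (reciprocal_pair l).2] | l <- s].
have AB : k *: \prod_(z <- A) ('X - z%:P) = \prod_(z <- B) ('X - z%:P).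
  have := Rpoly_comp_X2; rewrite -/P rsE comp_polyZ -[_ \Po _]/((comp_poly 'X^2) _) rmorph_prod.
  rewrite !prod_flatten_pair => E; apply: etrans (etrans E _).
    congr (_ *: _); apply: eq_bigr => z _; rewrite rmorphB /= comp_polyX comp_polyC.
    rewrite polyCN opprK -[in RHS](sqrtCK z) polyC_exp; ring.
  apply: eq_bigr => l _; have [h1 h2 _] := reciprocal_pairP l; rewrite -h1.
  move: h2; case: (reciprocal_pair l) => a b /= h2; rewrite -mul_polyC polyCD.
  have -> : 1 = a%:P * b%:P :> {poly algC} by rewrite -polyCM h2.
  by ring.
have lc : k = 1.
  have := congr1 lead_coef AB; rewrite lead_coefZ.
  by rewrite !(monicP (monic_prod_XsubC _ _ _)) mulr1.
move: AB; rewrite lc scale1r => /prod_XsubC_eq/permP/(_ (fun z => 1 < `|z|)).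
rewrite (@count_flatten_pair _ _ _ (fun z => 1 < `|z|) _ _ 2); last first.
  move=> z _; rewrite normrN addnn muln2; congr (_.*2); congr nat_of_bool.
  by rewrite -[in RHS](sqrtCK z) normrX expr_gt1.
rewrite (@count_flatten_pair _ _ _ (fun l => 2 < `|l|) _ _ 1); last first.
  by move=> l _; rewrite muln1; have [] := reciprocal_pairP l.
by rewrite muln1 count_norm_gt2 -muln2 => /eqP; rewrite eqn_pmul2r // => /eqP.
Qed.

End OutsideRoots.

(** * Salem trees *)

Section SalemTrees.
Variables (V : finType) (e : rel V).
Hypothesis sg : simple_graph e.
Implicit Types (S : {set V}) (r u v w : V).
Local Notation c S := (chi e algR S).
Local Notation T S r u := (tcomp e (S :\ r) u).

Lemma chi_root_opp S x : bipartite e S -> root (c S) x -> root (c S) (- x).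
Proof. by move=> bS /rootP rx; apply/rootP; rewrite horner_chiN // rx mulr0. Qed.

Let algRval2 : algRval 2 = 2.
Proof. exact: (rmorph_nat (@algRval : {rmorphism algR -> algC})). Qed.

Lemma cyclotomicP S : bipartite e S -> cyclotomic_graph e S <-> roots_le e S 2.
Proof.
move=> bS; split=> [h x rx|h a /(eigenvalue_chi sg)[x -> rx]].
  have /h/andP[_] : is_eigenvalue e S (algRval x) by apply/(eigenvalue_chi sg); exists x.
  by rewrite -algRval2.
rewrite -algRval2 -(rmorphN (@algRval : {rmorphism algR -> algC})).
have h1 : x <= 2 by apply: h.
have h2 : - 2 <= x by rewrite lerNl; apply: h; apply: chi_root_opp.
by apply/andP; split; [exact: h2 | exact: h1].
Qed.

Lemma roots_le_or S a : roots_le e S a \/ exists2 l, root (c S) l & a < l.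
Proof.
have [s sE] := chi_split sg S.
have [/hasP[l ls al]|/hasPn n] := boolP (has (fun l => a < l) s).
  by right; exists l; rewrite // sE root_prod_XsubC.
by left=> x; rewrite sE root_prod_XsubC => /n; rewrite -leNgt.
Qed.

(** Uniqueness concerns the value only; multiplicity is treated in [one_large_root_count]. *)
Definition one_large_root S := exists l, [/\ 2 < l, root (c S) l &
  forall x, root (c S) x -> 2 < x -> x = l].

Lemma salem_graphP S : bipartite e S -> salem_graph e S <-> one_large_root S.
Proof.
move=> bS; split=> [[_ [a [a2 /(eigenvalue_chi sg)[l aE rl] uq _]]]|[l [l2 rl uq]]].
  exists l; split=> //; first by move: a2; rewrite aE -algRval2.
  move=> x rx x2; apply: val_inj; rewrite /= -aE; apply: uq.
    by apply/(eigenvalue_chi sg); exists x.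
  by rewrite -algRval2.
split=> //; exists (algRval l); split.
- by rewrite -algRval2.
- by apply/(eigenvalue_chi sg); exists l.
- move=> _ /(eigenvalue_chi sg)[x -> rx]; rewrite -algRval2 => x2.
  by congr algRval; apply: uq.
move=> _ /(eigenvalue_chi sg)[x -> rx].
rewrite -algRval2 -!(rmorphN (@algRval : {rmorphism algR -> algC})) => x2.
congr algRval; rewrite -(uq (- x)) ?opprK //; first exact: chi_root_opp.
by rewrite ltrNr; exact: x2.
Qed.

Lemma forest_cyclotomicP S r : is_tree e S -> r \in S ->
  forest_cyclotomic e S r <-> roots_le e (S :\ r) 2.
Proof.
move=> tS rS; have bT u : u \in S -> e r u -> bipartite e (T S r u).
  by move=> uS eru; apply/(tree_bipartite sg)/tcomp_tree.
split=> [h|h u uS eru].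
  by apply: roots_le_D1 => // u uS eru; apply/cyclotomicP; [exact: bT | exact: h].
apply/cyclotomicP; first exact: bT.
by apply: roots_le_subset h => //; case: (nbr_subset sg rS uS eru).
Qed.

Lemma one_large_root_of_nu S r : is_tree e S -> r \in S -> roots_le e (S :\ r) 2 ->
  (2%:E < nu_forest e S r)%E -> one_large_root S.
Proof.
move=> tS rS ha nu2.
have [hS|[l rl l2]] := roots_le_or S 2.
  by move: nu2; rewrite ltNge (roots_le_nu_forest sg).
have main x y : root (c S) x -> root (c S) y -> 2 < x -> x < y -> False.
  move=> /rootP rx /rootP ry x2 xy; have := rquot_slope sg tS rS ha x2 (ltW xy).
  by rewrite /rquot rx ry !mul0r subrr; lra.
exists l; split=> // x rx x2; case: (ltgtP x l) => // h.
  by case: (main x l).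
by case: (main l x).
Qed.

Lemma nu_gt2_of_root S r : is_tree e S -> r \in S -> roots_le e (S :\ r) 2 ->
  ~ roots_le e S 2 -> (2%:E < nu_forest e S r)%E.
Proof. by move=> tS rS ha nS; rewrite ltNge; apply/negP => /(nu_forest_le2 sg tS rS ha). Qed.

Lemma tree_case_a S r : rooted_tree e S r -> forest_cyclotomic e S r ->
  ((2%:E < nu_forest e S r)%E -> salem_tree e S) /\
  ((nu_forest e S r <= 2%:E)%E -> is_tree e S /\ cyclotomic_graph e S).
Proof.
move=> [tS rS] /(forest_cyclotomicP tS rS) ha; have bS := tree_bipartite sg tS.
split=> h; split=> //.
  by apply/salem_graphP => //; apply: one_large_root_of_nu ha h.
by apply/cyclotomicP => //; apply: nu_forest_le2 h.
Qed.

(** The extra conclusion [~ one_large_root S] is what forces the bound on the product in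
    [tree_case_c]. *)
Lemma tree_case_b S1 S2 S r1 r2 : typeA e S1 r1 -> typeA e S2 r2 ->
  is_join e S1 r1 S2 r2 S ->
  (((nu_forest e S1 r1 - 2%:E) * (nu_forest e S2 r2 - 2%:E) <= 1%:E)%E -> salem_tree e S) /\
  ((1%:E < (nu_forest e S1 r1 - 2%:E) * (nu_forest e S2 r2 - 2%:E))%E ->
     nroots_outside (Rpoly e S) 2 /\ ~ one_large_root S).
Proof.
move=> [[t1 R1] c1 n1] [[t2 R2] c2 n2] J.
have /(forest_cyclotomicP t1 R1) a1 := c1; have /(forest_cyclotomicP t2 R2) a2 := c2.
have [l1 [l1_2 l1r _]] := one_large_root_of_nu t1 R1 a1 n1.
have [l2 [l2_2 l2r _]] := one_large_root_of_nu t2 R2 a2 n2.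
have tS := join_tree sg t1 t2 J; have bS := tree_bipartite sg tS.
have [x [rx x1 x2]] := join_upper_root sg J a1 a2 l1r l2r l1_2 l2_2.
have x0 := lt_trans l1_2 x1.
split=> h.
  split=> //; apply/salem_graphP => //; exists x; split=> // y ry y0.
  have [[y1 y2]|[y1 y2]] := join_root_cases sg J t1 t2 a1 a2 l1r l2r l1_2 l2_2 y0 ry.
    exact: (join_upper_unique sg J t1 t2 a1 a2 l1r l2r l1_2 l2_2).
  by case: (join_no_lower_root sg J t1 t2 a1 a2 l1r l2r n1 n2 h ry y0 y1 y2).
split.
  have [s sE] := chi_split sg S.
  have <- := join_count_roots sg J t1 t2 a1 a2 l1r l2r l1_2 l2_2 h sE.
  exact: nroots_outside_Rpoly.
have [y [ry y0 y1 y2]] := join_lower_root sg J t1 t2 a1 a2 l1r l2r l1_2 l2_2 h.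
move=> [l [_ _ uq]]; have := lt_trans y1 x1.
by rewrite (uq x) // (uq y) // ltxx.
Qed.

(** Bridges [one_large_root], which compares values, and [two_roots_gt], which counts multiplicity:
    at the largest root the denominator of [rquot] is positive and the slope is at least 1, so the
    root is simple. *)
Lemma one_large_root_count S s : is_tree e S -> one_large_root S ->
  c S = \prod_(l <- s) ('X - l%:P) -> (count (fun l => 2 < l)%R s <= 1)%N.
Proof.
move=> tS [l [l2 rl uq]] sE; have [/set0Pn[r rS] _] := tS.
have rs x : root (c S) x = (x \in s) by rewrite sE root_prod_XsubC.
have ha : roots_le e S l.
  by move=> x rx; case: (ltP 2 x) => [/(uq _ rx)->|/le_trans h] //; apply/h/ltW.
have ha' : roots_le e (S :\ r) l by apply: roots_le_subset ha => //; apply: subD1set.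
have pl := chi_D1_gt0 sg tS rS ha.
rewrite (_ : count _ s = count_mem l s); last first.
  apply: eq_in_count => x; rewrite -rs => rx /=; apply/idP/eqP => [/(uq _ rx)|->] //.
apply: (@count_mem_le1 _ s l (l + 1) 1 (c (S :\ r))) => //; first by lra.
move=> y ly _; have := rquot_slope_at sg tS rS ha' pl (lexx _) (ltW ly).
rewrite -sE {2}/rquot (rootP rl) mul0r subr0 mul1r /rquot ler_pdivlMr.
  by move=> h; apply: le_trans h (ler_norm _).
exact: (proj1 (roots_leP sg _ _) ha').
Qed.

Lemma tree_case_c S : salem_tree e S ->
  (exists r, typeA e S r) \/
  (exists (S1 S2 : {set V}) (r1 r2 : V),
     [/\ typeA e S1 r1, typeA e S2 r2,
        ((nu_forest e S1 r1 - 2%:E) * (nu_forest e S2 r2 - 2%:E) <= 1%:E)%E &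
        is_join e S1 r1 S2 r2 S]).
Proof.
move=> [tS sal]; have bS := tree_bipartite sg tS.
have /(salem_graphP bS) oS := sal.
have nS : ~ roots_le e S 2.
  by case: oS => l [l2 rl _] h; have := h l rl; rewrite leNgt l2.
have [S0 [cS _]] := tS.
have typeA_of_roots r S' : is_tree e S' -> r \in S' -> roots_le e (S' :\ r) 2 ->
    ~ roots_le e S' 2 -> typeA e S' r.
  move=> tS' rS' ha nS'; split=> //; first exact/forest_cyclotomicP.
  exact: nu_gt2_of_root.
have ex_split S' : exists s, chi e algR S' == \prod_(l <- s) ('X - l%:P).
  by have [s ->] := chi_split sg S'; exists s.
(* A boolean test for an eigenvalue above 2, as required by the finite search and minimisation
   below. *)
pose large S' := has (fun l => 2 < l) (xchoose (ex_split S')).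
have largeP S' : reflect (exists2 l, root (c S') l & 2 < l) (large S').
  apply: (iffP hasP) => -[l]; move: (eqP (xchooseP (ex_split S'))) => E h1 h2; exists l => //.
    by rewrite E root_prod_XsubC.
  by rewrite -root_prod_XsubC -E.
have smallP S' : ~~ large S' -> roots_le e S' 2.
  by move=> nl x rx; rewrite leNgt; apply: contra nl => x2; apply/largeP; exists x.
have largeN S' : large S' -> ~ roots_le e S' 2.
  by move=> /largeP[l rl l2] h; have := h l rl; rewrite leNgt l2.
pose bad (p : V * V) := [&& p.1 \in S, p.2 \in S, e p.1 p.2 & large (T S p.1 p.2)].
have [/existsP[p0 bp0]|/existsPn nbad] := boolP [exists p, bad p]; last first.
  (* If no oriented edge has a noncyclotomic branch, every vertex is a suitable root. *)
  have /set0Pn[r rS] := S0; left; exists r; apply: typeA_of_roots => //.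
  apply: roots_le_D1 => // u uS eru; apply: smallP.
  by have := nbad (r, u); rewrite /bad /= rS uS eru.
case: (arg_minnP (fun p : V * V => #|T S p.1 p.2|) bp0) => -[r u] /= /and4P[/= rS uS eru lg] minp.
have eur : e u r by case: sg => <-.
have J := tree_edge_split sg tS rS uS eru; have J' := J.
case: J' => dis SE r1 u2 eE.
have t1 : is_tree e (T S u r) by apply: tcomp_tree.
have t2 : is_tree e (T S r u) by apply: tcomp_tree.
(* The branch at such a [w] lies inside the chosen branch and misses [u], so minimality makes it
   cyclotomic. *)
have small_nbr w : w \in S -> e u w -> w != r -> roots_le e (T S u w) 2.
  move=> wS euw wr; apply: smallP; apply/negP => lw.
  have := minp (u, w); rewrite /bad /= uS wS euw lw => /(_ isT).
  have sub := tcomp_sub_tcomp sg tS uS rS eur wS euw wr.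
  have uT : u \notin T S u w.
    by apply/negP => /(subsetP (tcomp_D1_sub sg uS wS euw)); rewrite !inE eqxx.
  rewrite leqNgt => /negP[]; apply: proper_card; apply/properP; split=> //.
  by exists u.
have a2 : roots_le e (T S r u :\ u) 2.
  apply: roots_le_D1 => // w wT euw.
  have [wr wS] : w != r /\ w \in S.
    by have /(subsetP (tcomp_D1_sub sg rS uS eru)) := wT; rewrite !inE => /andP[].
  apply: roots_le_subset (small_nbr w wS euw wr) => //.
  apply: tcomp_mono; apply: setSD.
  exact: subset_trans (tcomp_D1_sub sg rS uS eru) (subD1set _ _).
have A2 : typeA e (T S r u) u by apply: typeA_of_roots => //; apply: largeN.
have a1 : roots_le e (T S u r :\ r) 2.
  apply: roots_le_D1 => // w wT erw.
  have [wu wS] : w != u /\ w \in S.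
    by have /(subsetP (tcomp_D1_sub sg uS rS eur)) := wT; rewrite !inE => /andP[].
  (* A second noncyclotomic branch at [r] would be disjoint from and nonadjacent to the one at [u],
     giving two eigenvalues above 2. *)
  have sw : roots_le e (T S r w) 2.
    apply: smallP; apply/negP => /largeP[y ry y2]; case/largeP: lg => x rx x2.
    have [s sE] := chi_split sg S; have := one_large_root_count tS oS sE.
    rewrite leqNgt => /negP[].
    apply: (two_roots_gt sg _ _ _ _ rx ry x2 y2 sE).
    - exact: subset_trans (tcomp_D1_sub sg rS uS eru) (subD1set _ _).
    - exact: subset_trans (tcomp_D1_sub sg rS wS erw) (subD1set _ _).
    - by apply: tcomp_disjoint => //; rewrite eq_sym.
    by move=> *; apply: (tcomp_no_edge sg tS rS uS eru wS erw) => //; rewrite eq_sym.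
  apply: roots_le_subset sw => //; apply: tcomp_mono; apply: setSD.
  exact: subset_trans (tcomp_D1_sub sg uS rS eur) (subD1set _ _).
(* If the side of [r] is cyclotomic, it is just another cyclotomic branch at [u], and [S] rooted at
   [u] is of type (a). *)
have [l1|l1] := boolP (large (T S u r)); last first.
  left; exists u; apply: typeA_of_roots => //; apply: roots_le_D1 => // w wS euw.
  by have [->|wr] := eqVneq w r; [apply: smallP | apply: small_nbr].
have A1 : typeA e (T S u r) r by apply: typeA_of_roots => //; apply: largeN.
right; exists (T S u r), (T S r u), r, u; split=> //.
(* A product above 1 would give [S] a second eigenvalue above 2. *)
by rewrite leNgt; apply/negP => gt1; have [_ /(_ gt1)[_]] := tree_case_b A1 A2 J.
Qed.

End SalemTrees.

Theorem theorem16 :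
  (* (a) *)
  (forall (V : finType) (e : rel V) (S : {set V}) (r : V),
     simple_graph e -> rooted_tree e S r -> forest_cyclotomic e S r ->
     ((2%:E < nu_forest e S r)%E -> salem_tree e S) /\
     ((nu_forest e S r <= 2%:E)%E -> is_tree e S /\ cyclotomic_graph e S)) /\
  (* (b) *)
  (forall (V : finType) (e : rel V) (S1 S2 S : {set V}) (r1 r2 : V),
     simple_graph e -> typeA e S1 r1 -> typeA e S2 r2 ->
     is_join e S1 r1 S2 r2 S ->
     (((nu_forest e S1 r1 - 2%:E) * (nu_forest e S2 r2 - 2%:E) <= 1%:E)%E ->
        salem_tree e S) /\
     ((1%:E < (nu_forest e S1 r1 - 2%:E) * (nu_forest e S2 r2 - 2%:E))%E ->
        nroots_outside (Rpoly e S) 2)) /\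
  (* (c) *)
  (forall (V : finType) (e : rel V) (S : {set V}),
     simple_graph e -> salem_tree e S ->
     (exists r, typeA e S r) \/
     (exists (S1 S2 : {set V}) (r1 r2 : V),
        [/\ typeA e S1 r1, typeA e S2 r2,
            ((nu_forest e S1 r1 - 2%:E) * (nu_forest e S2 r2 - 2%:E) <= 1%:E)%E &
            is_join e S1 r1 S2 r2 S])).
Proof.
split; [|split].
- by move=> V e S r sg; apply: tree_case_a.
- move=> V e S1 S2 S r1 r2 sg A1 A2 J; have [hle hgt] := tree_case_b sg A1 A2 J.
  by split=> // /hgt[].
- by move=> V e S sg; apply: tree_case_c.
Qed.
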